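(* (Strengthened Cauchy–Schwarz inequality.) There is a constant $\gamma$ with $0\le\gamma<1$, depending only on $\alpha_0$, $\alpha_1$ and the constant $\rho$ described in the context, such that for any $\boldsymbol z\in\boldsymbol{\mathcal Z}$ and any $\boldsymbol v\in\boldsymbol V^{CR}$ $$\mathcal A(\boldsymbol z,\boldsymbol v)^2\ \le\ \gamma^2\,\mathcal A(\boldsymbol z,\boldsymbol z)\,\mathcal A(\boldsymbol v,\boldsymbol v).$$
   Context: Mesh. $\Omega\subset\mathbb R^d$, $d\in\{2,3\}$, is a polygon/polyhedron, $\partial\Omega=\Gamma_D\cup\Gamma_N$ (either part may be empty). $\mathcal T_h$ is a conforming (no hanging nodes) shape-regular partition of $\Omega$ into simplices $T$ of diameter $h_T$, $h=\max_T h_T$; the shape-regularity constant is a bound on $\max_T h_T/r_T$, $r_T$ the inradius. $\mathcal E_h^o$ is the set of interior faces ($(d-1)$-dimensional simplices); each boundary face belongs either to the set $\mathcal E_h^D$ of faces on $\Gamma_D$ or to the set $\mathcal E_h^N$ of faces on $\Gamma_N$. $h_E$ is the diameter of the face $E$. Each face $E$ carries a fixed unit normal $\boldsymbol n$ (outward to $\Omega$ on boundary faces); for interior $E$, $T^+$ (resp. $T^-$) is the neighbor for which $\boldsymbol n$ is outward (resp. inward). Traces. On interior faces $\{\!\{w\}\!\}=(w^++w^-)/2$ and $[\![w]\!]=w^+-w^-$, where $w^\pm$ are the traces from $T^\pm$; on boundary faces $\{\!\{w\}\!\}=[\![w]\!]=w$. $\mathcal P_E^0 w=\frac1{|E|}\int_E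 w$ is the $L^2(E)$-projection onto constants (componentwise for vectors). Spaces. $\boldsymbol V^{DG}$ is the space of vector fields in $[L^2(\Omega)]^d$ whose restriction to each $T\in\mathcal T_h$ lies in $[\mathbb P^1(T)]^d$ (affine). Put $$\boldsymbol V^{CR}=\{\boldsymbol v\in\boldsymbol V^{DG}:\mathcal P^0_E[\![\boldsymbol v]\!]=0\ \ \forall E\in\mathcal E_h^o\cup\mathcal E_h^D\},\qquad \boldsymbol{\mathcal Z}=\{\boldsymbol z\in\boldsymbol V^{DG}:\mathcal P^0_E\{\!\{\boldsymbol z\}\!\}=0\ \ \forall E\in\mathcal E_h^o\cup\mathcal E_h^N\}.$$ Bilinear forms. $0<\mu_1<\mu<\mu_2$ and $0\le\lambda<\infty$ are the (constant) Lamé parameters, $\mathcal C A=2\mu A+\lambda\,\mathrm{trace}(A)I$ for symmetric $A$, $\boldsymbol\varepsilon(\boldsymbol u)=\frac12(\nabla\boldsymbol u+(\nabla\boldsymbol u)^T)$ (elementwise), $\beta_0=d\lambda+2\mu$, $\beta_1=2\mu$. With $\langle\cdot:\cdot\rangle$ the Frobenius product, $$\mathcal A_0(\boldsymbol u,\boldsymbol w)=\sum_{T}\int_T\langle\mathcal C\boldsymbol\varepsilon(\boldsymbol u):\boldsymbol\varepsilon(\boldsymbol w)\rangle-\sum_{E\in\mathcal E_h^o\cup\mathcal E_h^D}\int_E\Big(\langle\{\!\{(\mathcal C\boldsymbol\varepsilon(\boldsymbol u))\boldsymbol n\}\!\},[\![\boldsymbol w]\!]\rangle+\langle[\![\boldsymbol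 u]\!],\{\!\{(\mathcal C\boldsymbol\varepsilon(\boldsymbol w))\boldsymbol n\}\!\}\rangle\Big)+\alpha_0\beta_0\sum_{E\in\mathcal E_h^o\cup\mathcal E_h^D}h_E^{-1}\int_E\langle[\![\boldsymbol u]\!],\mathcal P_E^0[\![\boldsymbol w]\!]\rangle,$$ $$\mathcal A(\boldsymbol u,\boldsymbol w)=\mathcal A_0(\boldsymbol u,\boldsymbol w)+\alpha_1\beta_1\sum_{E\in\mathcal E_h^o\cup\mathcal E_h^D}h_E^{-1}\int_E\langle[\![\boldsymbol u]\!],[\![\boldsymbol w]\!]\rangle.$$ Standing assumption on penalties: $\alpha_1>0$, and $\alpha_0\ge1$ is chosen large enough (depending only on $d$ and shape regularity) that for all $\boldsymbol v\in\boldsymbol V^{DG}$ $$\mathcal A_0(\boldsymbol v,\boldsymbol v)\ge\tfrac12\sum_T\int_T\langle\mathcal C\boldsymbol\varepsilon(\boldsymbol v):\boldsymbol\varepsilon(\boldsymbol v)\rangle+\tfrac{\alpha_0}{2}\beta_0\sum_{E\in\mathcal E_h^o\cup\mathcal E_h^D}h_E^{-1}\|\mathcal P^0_E[\![\boldsymbol v]\!]\|_{0,E}^2 .$$ The constant $\rho$: $\rho\ge1$ is a constant depending only on $d$ and the shape regularity of the mesh such that for all $\boldsymbol z\in\boldsymbol{\mathcal Z}$ $$\sum_{E\in\mathcal E_h^o\cup\mathcal E_h^D}h_E^{-1}\|[\![\boldsymbol z]\!]-\mathcal P^0_E[\![\boldsymbol z]\!]\|_{0,E}^2\le\Big(1-\frac1\rho\Big)\sum_{E\in\mathcal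 E_h^o\cup\mathcal E_h^D}h_E^{-1}\|[\![\boldsymbol z]\!]\|_{0,E}^2 .$$ *)

(* Defs.v *)
From HB Require Import structures.
From mathcomp Require Export all_boot all_order all_algebra.
From mathcomp Require Export all_classical all_reals all_analysis.
Export Order.TTheory GRing.Theory Num.Theory.
Export numFieldNormedType.Exports.

Set Implicit Arguments.
Unset Strict Implicit.
Unset Printing Implicit Defensive.

Local Open Scope classical_set_scope.
Local Open Scope ring_scope.

(* The library norm on 'rV[R]_n is the sup norm, hence the explicit Euclidean
   structure. *)
Definition dot {R : realType} {n : nat} (u v : 'rV[R]_n) : R :=
  \sum_i u 0 i * v 0 i.

Definition enorm {R : realType} {n : nat} (u : 'rV[R]_n) : R :=
  Num.sqrt (dot u u).

Definition frob {R : realType} {n : nat} (A B : 'M[R]_n) : R :=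
  \sum_i \sum_j A i j * B i j.

Definition diam {R : realType} {n : nat} (A : set 'rV[R]_n) : R :=
  sup [set r | exists x y, [/\ A x, A y & r = enorm (x - y)]].

Definition inradius {R : realType} {n : nat} (A : set 'rV[R]_n) : R :=
  sup [set r | 0 <= r /\
    exists c, forall y, enorm (y - c) <= r -> A y].

(* Iterated Lebesgue integral over {t in R^k : t_i >= 0, sum_i t_i <= s}. *)
Fixpoint std_int {R : realType} (k : nat) (s : R) :
    ('rV[R]_k -> R) -> R :=
  match k with
  | 0 => fun f => f 0
  | k'.+1 => fun f =>
      \int[lebesgue_measure]_(t in `[0, s])
         std_int (s - t) (fun u : 'rV[R]_k' => f (row_mx t%:M u))
  end.

(* Mesh data.  A simplex is encoded by the set of (the indices of) its
   vertices; cells lists the elements T of the mesh.  A face is a set of d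
   vertices of a cell, and normal gives its fixed unit normal. *)
Record mesh (R : realType) (d : nat) := Mesh {
  nv : nat;
  vtx : 'I_nv -> 'rV[R]_d;
  cells : {set {set 'I_nv}};
  facesD : {set {set 'I_nv}};
  facesN : {set {set 'I_nv}};
  normal : {set 'I_nv} -> 'rV[R]_d }.

Arguments nv {R d} m.
Arguments vtx {R d} m.
Arguments cells {R d} m.
Arguments facesD {R d} m.
Arguments facesN {R d} m.
Arguments normal {R d} m.

Definition simplex {R : realType} {d : nat} (M : mesh R d)
    (S : {set 'I_(nv M)}) : set 'rV[R]_d :=
  [set y | exists l : 'I_(nv M) -> R,
    [/\ forall i, 0 <= l i, forall i, i \notin S -> l i = 0,
        \sum_i l i = 1 & y = \sum_i l i *: vtx M i]].

Definition aff_indep {R : realType} {d : nat} (M : mesh R d)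
    (S : {set 'I_(nv M)}) : Prop :=
  forall l : 'I_(nv M) -> R,
    (forall i, i \notin S -> l i = 0) ->
    \sum_i l i = 0 -> \sum_i l i *: vtx M i = 0 -> forall i, l i = 0.

Definition neighbors {R : realType} {d : nat} (M : mesh R d)
    (E : {set 'I_(nv M)}) : {set {set 'I_(nv M)}} :=
  [set T in cells M | E \subset T]%SET.

Definition faces_int {R : realType} {d : nat} (M : mesh R d) :
    {set {set 'I_(nv M)}} :=
  [set E : {set 'I_(nv M)} | (#|E| == d) && (#|neighbors E| == 2%N)]%SET.

Definition faces_bd {R : realType} {d : nat} (M : mesh R d) :
    {set {set 'I_(nv M)}} :=
  [set E : {set 'I_(nv M)} | (#|E| == d) && (#|neighbors E| == 1%N)]%SET.

Definition faces_oD {R : realType} {d : nat} (M : mesh R d) :=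
  (faces_int M :|: facesD M)%SET.

Definition faces_oN {R : realType} {d : nat} (M : mesh R d) :=
  (faces_int M :|: facesN M)%SET.

Definition outward {R : realType} {d : nat} (M : mesh R d)
    (T E : {set 'I_(nv M)}) : bool :=
  [forall i in (T :\: E)%SET, forall j in E,
     dot (normal M E) (vtx M i - vtx M j) < 0].

Definition inward {R : realType} {d : nat} (M : mesh R d)
    (T E : {set 'I_(nv M)}) : bool :=
  [forall i in (T :\: E)%SET, forall j in E,
     0 < dot (normal M E) (vtx M i - vtx M j)].

(* M is a conforming simplicial partition of the polygon/polyhedron Omega whose
   boundary is split into GammaD and GammaN.  That Omega is polyhedral is
   expressed by its being the interior of a finite union of simplices. *)
Record conforming_mesh {R : realType} {d : nat}
    (Omega GammaD GammaN : set 'rV[R]_d) (M : mesh R d) : Prop :=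
  ConformingMesh {
  cm_nonempty : Omega !=set0;
  cm_open : open Omega;
  cm_regular : interior (closure Omega) = Omega;
  cm_inj : injective (vtx M);
  cm_cell_card : forall T, T \in cells M -> #|T| = d.+1;
  cm_cell_indep : forall T, T \in cells M -> aff_indep T;
  cm_cover : closure Omega = [set y | exists2 T, T \in cells M & simplex T y];
  cm_conforming : forall T1 T2, T1 \in cells M -> T2 \in cells M ->
    simplex T1 `&` simplex T2 = simplex (T1 :&: T2)%SET;
  cm_boundary : GammaD `|` GammaN = closure Omega `\` Omega;
  cm_faces_bd : (facesD M :|: facesN M)%SET = faces_bd M;
  cm_faces_disj : (facesD M :&: facesN M)%SET = finset.set0;
  cm_facesD : forall E, E \in facesD M -> simplex E `<=` GammaD;
  cm_facesN : forall E, E \in facesN M -> simplex E `<=` GammaN;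
  cm_normal_unit : forall E, E \in (faces_int M :|: faces_bd M)%SET ->
    enorm (normal M E) = 1;
  cm_normal_orth : forall E, E \in (faces_int M :|: faces_bd M)%SET ->
    forall i j, i \in E -> j \in E ->
      dot (normal M E) (vtx M i - vtx M j) = 0;
  cm_normal_out : forall E, E \in faces_bd M ->
    forall T, T \in neighbors E -> outward T E }.

Definition shape_regular {R : realType} {d : nat} (M : mesh R d) (sigma : R) :
    Prop :=
  forall T, T \in cells M -> diam (simplex T) / inradius (simplex T) <= sigma.

(* Integral over the simplex spanned by S with respect to its k-dimensional
   surface measure, k = #|S|.-1, by the affine parametrization
   t |-> p_0 + sum_i t_i (p_(i+1) - p_0) and its Gram determinant (so that it is
   the Lebesgue integral on cells). *)
Definition verts {R : realType} {d : nat} (M : mesh R d)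
    (S : {set 'I_(nv M)}) : seq 'rV[R]_d :=
  [seq vtx M i | i <- enum S].

Definition edges_mx {R : realType} {d : nat} (M : mesh R d)
    (S : {set 'I_(nv M)}) : 'M[R]_(#|S|.-1, d) :=
  \matrix_(i < #|S|.-1) ((verts S)`_i.+1 - (verts S)`_0).

Definition sint {R : realType} {d : nat} (M : mesh R d)
    (S : {set 'I_(nv M)}) (f : 'rV[R]_d -> R) : R :=
  Num.sqrt (\det (edges_mx S *m (edges_mx S)^T)) *
  std_int 1 (fun t => f ((verts S)`_0 + t *m edges_mx S)).

Definition P0 {R : realType} {d n : nat} (M : mesh R d)
    (E : {set 'I_(nv M)}) (w : 'rV[R]_d -> 'rV[R]_n) : 'rV[R]_n :=
  \row_i ((sint E (fun=> 1))^-1 * sint E (fun x => w x 0 i)).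

Definition L2sq {R : realType} {d n : nat} (M : mesh R d)
    (E : {set 'I_(nv M)}) (w : 'rV[R]_d -> 'rV[R]_n) : R :=
  sint E (fun x => dot (w x) (w x)).

(* Piecewise smooth fields are families indexed by the cells: w T is the smooth
   extension of the restriction of the field to T, so that its trace from T on
   a face E of T is the restriction of w T to E. *)
Definition pw {R : realType} {d : nat} (M : mesh R d) : Type :=
  {set 'I_(nv M)} -> 'rV[R]_d -> 'rV[R]_d.

Definition Tplus {R : realType} {d : nat} (M : mesh R d)
    (E : {set 'I_(nv M)}) : {set 'I_(nv M)} :=
  odflt finset.set0 [pick T in neighbors E | outward T E].

Definition Tminus {R : realType} {d : nat} (M : mesh R d)
    (E : {set 'I_(nv M)}) : {set 'I_(nv M)} :=
  odflt finset.set0 [pick T in neighbors E | inward T E].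

(* On a boundary face the normal is outward, so Tplus E is its only cell. *)
Definition avg {R : realType} {d : nat} {M : mesh R d} (w : pw M)
    (E : {set 'I_(nv M)}) (x : 'rV[R]_d) : 'rV[R]_d :=
  if E \in faces_int M then 2^-1 *: (w (Tplus E) x + w (Tminus E) x)
  else w (Tplus E) x.

Definition jump {R : realType} {d : nat} {M : mesh R d} (w : pw M)
    (E : {set 'I_(nv M)}) (x : 'rV[R]_d) : 'rV[R]_d :=
  if E \in faces_int M then w (Tplus E) x - w (Tminus E) x
  else w (Tplus E) x.

Definition affine_field {R : realType} {d : nat} (f : 'rV[R]_d -> 'rV[R]_d) :
    Prop :=
  exists (A : 'M[R]_d) (b : 'rV[R]_d), forall x, f x = x *m A + b.

Definition VDG {R : realType} {d : nat} {M : mesh R d} (v : pw M) : Prop :=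
  forall T, T \in cells M -> affine_field (v T).

Definition VCR {R : realType} {d : nat} {M : mesh R d} (v : pw M) : Prop :=
  VDG v /\ forall E, E \in faces_oD M -> P0 E (jump v E) = 0.

Definition Zspace {R : realType} {d : nat} {M : mesh R d} (z : pw M) : Prop :=
  VDG z /\ forall E, E \in faces_oN M -> P0 E (avg z E) = 0.

(* 'J u x acts on row vectors from the right, so (nabla u)_ij = d_j u_i is its
   transpose. *)
Definition eps {R : realType} {d : nat} (u : 'rV[R]_d -> 'rV[R]_d)
    (x : 'rV[R]_d) : 'M[R]_d :=
  2^-1 *: (('J u x)^T + 'J u x).

Definition elast {R : realType} {d : nat} (mu lambda : R) (A : 'M[R]_d) :
    'M[R]_d :=
  (2 * mu) *: A + (lambda * \tr A)%:M.

Definition traction {R : realType} {d : nat} {M : mesh R d} (mu lambda : R)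
    (u : pw M) (E : {set 'I_(nv M)}) : pw M :=
  fun T x => normal M E *m (elast mu lambda (eps (u T) x))^T.

Definition hE {R : realType} {d : nat} (M : mesh R d)
    (E : {set 'I_(nv M)}) : R := diam (simplex E).

Definition beta0 {R : realType} (d : nat) (mu lambda : R) : R :=
  d%:R * lambda + 2 * mu.

Definition beta1 {R : realType} (mu : R) : R := 2 * mu.

Definition energy {R : realType} {d : nat} {M : mesh R d} (mu lambda : R)
    (u w : pw M) : R :=
  \sum_(T in cells M)
    sint T (fun x => frob (elast mu lambda (eps (u T) x)) (eps (w T) x)).

Definition formA0 {R : realType} {d : nat} {M : mesh R d}
    (mu lambda alpha0 : R) (u w : pw M) : R :=
  energy mu lambda u w
  - \sum_(E in faces_oD M)
      sint E (fun x => dot (avg (traction mu lambda u E) E x) (jump w E x)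
                     + dot (jump u E x) (avg (traction mu lambda w E) E x))
  + alpha0 * beta0 d mu lambda *
    \sum_(E in faces_oD M)
      (hE E)^-1 * sint E (fun x => dot (jump u E x) (P0 E (jump w E))).

Definition formA {R : realType} {d : nat} {M : mesh R d}
    (mu lambda alpha0 alpha1 : R) (u w : pw M) : R :=
  formA0 mu lambda alpha0 u w
  + alpha1 * beta1 mu *
    \sum_(E in faces_oD M)
      (hE E)^-1 * sint E (fun x => dot (jump u E x) (jump w E x)).

Definition penalty_ok {R : realType} {d : nat} (M : mesh R d)
    (mu lambda alpha0 : R) : Prop :=
  forall v : pw M, VDG v ->
    2^-1 * energy mu lambda v v
    + alpha0 / 2 * beta0 d mu lambda *
      \sum_(E in faces_oD M)
        (hE E)^-1 * L2sq E (fun=> P0 E (jump v E))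
    <= formA0 mu lambda alpha0 v v.

Definition rho_ok {R : realType} {d : nat} (M : mesh R d) (rho : R) : Prop :=
  forall z : pw M, Zspace z ->
    \sum_(E in faces_oD M)
      (hE E)^-1 * L2sq E (fun x => jump z E x - P0 E (jump z E))
    <= (1 - rho^-1) *
       \sum_(E in faces_oD M) (hE E)^-1 * L2sq E (jump z E).

(* Main.v *)
(** Integrating by parts cell by cell, where the stress of [v] is constant,
    moves [A_0(z, v)] onto the faces; there every term pairs a constant with the
    mean of the average of [z] or with the mean of the jump of [v], so
    [A_0(z, v) = 0].  What is left of [A(z, v)] is the [alpha1] penalty, in which
    the mean of the jump of [z] may be subtracted because the jump of [v] has
    mean zero.  Cauchy-Schwarz, the definition of [rho] and the positivity of
    [A_0] give the claim with [gamma = sqrt (1 - 1 / rho)].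

    The integration by parts rests on two facts.  The outward normal of the
    facet opposite to the vertex [i], scaled by the area of the facet, pairs
    with an edge [p_a - p_b] as [- d |T| (delta_ai - delta_bi)]: this is
    "volume = base * height / d" in terms of Gram determinants.  And by
    conformity a facet has at most two cells, one on each side. *)

Require Import Defs.
From mathcomp Require Import ring.

Set Implicit Arguments.
Unset Strict Implicit.
Unset Printing Implicit Defensive.

Local Open Scope classical_set_scope.
Local Open Scope ring_scope.

(** * Integration of polynomials over the standard simplex *)

Section PolynomialIntegrals.
Variable R : realType.
Implicit Types (p q : {poly R}) (s t : R).
Local Notation mu := (@lebesgue_measure R).

Lemma integrable_horner p s : mu.-integrable `[0, s] (EFin \o (fun t => p.[t])).
Proof.
apply: continuous_compact_integrable; first exact: segment_compact.
by apply: continuous_subspaceT => x; exact: continuous_horner.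
Qed.

Lemma Rintegral_hornerD p q s :
  \int[mu]_(t in `[0, s]) (p + q).[t]
  = \int[mu]_(t in `[0, s]) p.[t] + \int[mu]_(t in `[0, s]) q.[t].
Proof.
rewrite -RintegralD //; try exact: integrable_horner.
by apply: eq_Rintegral => t _; rewrite hornerD.
Qed.

Lemma Rintegral_hornerZ c p s :
  \int[mu]_(t in `[0, s]) (c *: p).[t] = c * \int[mu]_(t in `[0, s]) p.[t].
Proof.
rewrite -RintegralZl //; last exact: integrable_horner.
by apply: eq_Rintegral => t _; rewrite hornerZ.
Qed.

Lemma Rintegral_horner_sum (I : finType) (p : I -> {poly R}) s :
  \int[mu]_(t in `[0, s]) (\sum_i p i).[t]
  = \sum_i \int[mu]_(t in `[0, s]) (p i).[t].
Proof.
elim/big_ind2: _ => [|_ p1 _ p2 <- <-|//]; last exact: Rintegral_hornerD.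
by rewrite -(scale0r (0 : {poly R})) Rintegral_hornerZ mul0r.
Qed.

Lemma Rintegral_deriv p s : 0 <= s ->
  \int[mu]_(t in `[0, s]) p^`().[t] = p.[s] - p.[0].
Proof.
rewrite le_eqVlt => /predU1P[<-|s_gt0].
  by rewrite set_itv1 Rintegral_set1 subrr.
rewrite /Rintegral (@continuous_FTC2 _ _ (horner p)) //.
- by apply: continuous_subspaceT => x; exact: continuous_horner.
- split=> [x _||]; first exact: derivable_horner.
  + by apply: cvg_at_right_filter; exact: continuous_horner.
  + by apply: cvg_at_left_filter; exact: continuous_horner.
- by move=> x _; rewrite derivE.
Qed.

(** Euler's beta integral, by induction on [j] for all [e]: one factor s - X splits the integral
    into s times the case (e, j) minus the case (e + 1, j). *)
Lemma Rintegral_beta e j s : 0 <= s ->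
  \int[mu]_(t in `[0, s]) ('X^e * (s%:P - 'X) ^+ j).[t]
  = e`!%:R * j`!%:R / (e + j).+1`!%:R * s ^+ (e + j).+1.
Proof.
have nz n : n`!%:R != 0 :> R by rewrite pnatr_eq0 -lt0n fact_gt0.
move=> s_ge0; elim: j e => [|j IHj] e.
  have -> : 'X^e * (s%:P - 'X) ^+ 0 = (e.+1%:R^-1 *: 'X^(e.+1))^`() :> {poly R}.
    rewrite expr0 mulr1 derivZ derivXn /= -scalerMnr scalerMnl -mulr_natr.
    by rewrite mulVf ?scale1r ?pnatr_eq0.
  rewrite Rintegral_deriv // !hornerE expr0n mulr0 subr0.
  by rewrite factS natrM invfM mulrCA mulfV ?mulr1.
have -> : 'X^e * (s%:P - 'X) ^+ j.+1
    = s *: ('X^e * (s%:P - 'X) ^+ j) + (-1) *: ('X^(e.+1) * (s%:P - 'X) ^+ j)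
    :> {poly R}.
  by rewrite -!mul_polyC !exprS polyCN polyC1; ring.
rewrite Rintegral_hornerD !Rintegral_hornerZ !IHj addnS addSn.
rewrite (factS (e + j).+1) (factS e) (factS j) !natrM !exprS.
field; rewrite nz /=.
by rewrite -natrD nat1r -natrD !pnatr_eq0.
Qed.

End PolynomialIntegrals.

(** Polynomial functions given by closure rules. The integrands met for piecewise affine fields are
    of this kind, and induction on the rules settles the integrability questions raised by the
    iterated integral. *)
Inductive polyfun {R : realType} {k : nat} : ('rV[R]_k -> R) -> Prop :=
| polyfun_cst c : polyfun (fun=> c)
| polyfun_coord i : polyfun (fun x => x 0 i)
| polyfunD f g : polyfun f -> polyfun g -> polyfun (fun x => f x + g x)
| polyfunM f g : polyfun f -> polyfun g -> polyfun (fun x => f x * g x).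

Section PolyfunTheory.
Variable R : realType.

Lemma polyfun_ext k (f g : 'rV[R]_k -> R) : f =1 g -> polyfun f -> polyfun g.
Proof. by move=> /funext->. Qed.

Lemma polyfunB k (f g : 'rV[R]_k -> R) :
  polyfun f -> polyfun g -> polyfun (fun x => f x - g x).
Proof.
move=> pf pg; apply: (@polyfun_ext _ (fun x => f x + (-1) * g x)).
  by move=> x; rewrite mulN1r.
by apply: polyfunD => //; apply: polyfunM => //; exact: polyfun_cst.
Qed.

Lemma polyfun_sum k (I : Type) (r : seq I) (g : I -> 'rV[R]_k -> R) :
  (forall i, polyfun (g i)) -> polyfun (fun x => \sum_(i <- r) g i x).
Proof.
move=> pg; elim: r => [|i r IHr].
  by apply: polyfun_ext (polyfun_cst 0) => x; rewrite big_nil.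
by apply: polyfun_ext (polyfunD (pg i) IHr) => x; rewrite big_cons.
Qed.

Lemma polyfun_affine k l (f : 'rV[R]_l -> R) (A : 'M[R]_(k, l)) (b : 'rV[R]_l) :
  polyfun f -> polyfun (fun x => f (b + x *m A)).
Proof.
elim=> [c|i|g h _ pg _ ph|g h _ pg _ ph]; first exact: polyfun_cst.
- apply: (@polyfun_ext _ (fun x => b 0 i + \sum_j x 0 j * A j i)).
    by move=> x; rewrite !mxE.
  apply: polyfunD; first exact: polyfun_cst.
  apply: polyfun_sum => j.
  by apply: polyfunM; [exact: polyfun_coord | exact: polyfun_cst].
- exact: polyfunD.
- exact: polyfunM.
Qed.

Lemma row_scalar_mxEl k (t : R) (u : 'rV[R]_k) (j : 'I_1) :
  (row_mx t%:M u : 'rV[R]_k.+1) 0 (lshift k j) = t.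
Proof. by apply: etrans (row_mxEl _ _ _ _) _; rewrite ord1 mxE eqxx. Qed.

Lemma row_scalar_mxEr k (t : R) (u : 'rV[R]_k) (j : 'I_k) :
  (row_mx t%:M u : 'rV[R]_k.+1) 0 (rshift 1 j) = u 0 j.
Proof. exact: row_mxEr. Qed.

Lemma polyfun_slice k (f : 'rV[R]_k.+1 -> R) (t : R) :
  polyfun f -> polyfun (fun u : 'rV[R]_k => f (row_mx t%:M u)).
Proof.
elim=> [c|i|g h _ pg _ ph|g h _ pg _ ph]; first exact: polyfun_cst.
- have [j ->|j ->] := @split_ordP 1 k i.
    by apply: polyfun_ext (polyfun_cst t) => u; rewrite row_scalar_mxEl.
  by apply: polyfun_ext (polyfun_coord j) => u; rewrite row_scalar_mxEr.
- exact: polyfunD.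
- exact: polyfunM.
Qed.

(** Expansion in powers of the first coordinate, the variable of the outermost integral in
    [std_int]. *)
Lemma polyfun_expand k (f : 'rV[R]_k.+1 -> R) : polyfun f ->
  exists (I : finType) (e : I -> nat) (g : I -> 'rV[R]_k -> R),
    (forall i, polyfun (g i)) /\
    (forall t u, f (row_mx t%:M u) = \sum_i t ^+ e i * g i u).
Proof.
elim=> {f} [c|i|f1 f2 _ [I [e [f [pf f1E]]]] _ [J [e' [g [pg f2E]]]]
              |f1 f2 _ [I [e [f [pf f1E]]]] _ [J [e' [g [pg f2E]]]]].
- exists unit, (fun=> 0%N), (fun _ _ => c); split=> [_|t u].
    exact: polyfun_cst.
  by rewrite (big_pred1 tt) ?mul1r // => -[].
- have [j ->|j ->] := @split_ordP 1 k i.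
    exists unit, (fun=> 1%N), (fun _ _ => 1); split=> [_|t u].
      exact: polyfun_cst.
    rewrite (big_pred1 tt) => [|[] //].
    by rewrite row_scalar_mxEl mulr1.
  exists unit, (fun=> 0%N), (fun _ u => u 0 j); split=> [_|t u].
    exact: polyfun_coord.
  by rewrite (big_pred1 tt) => [|[] //]; rewrite row_scalar_mxEr mul1r.
- exists (I + J)%type, (fun i => match i with inl i => e i | inr j => e' j end),
    (fun i => match i with inl i => f i | inr j => g j end); split=> [[]//|t u].
  by rewrite big_sumType /= f1E f2E.
- exists (I * J)%type, (fun i => e i.1 + e' i.2)%N,
    (fun i u => f i.1 u * g i.2 u); split=> [i|t u]; first exact: polyfunM.
  rewrite f1E f2E big_distrlr pair_bigA; apply: eq_bigr => i _ /=.
  by rewrite exprD mulrACA.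
Qed.

(** The inner formula is requested for t <= s alone: the outer integral sees no other t, and
    formulas for inner integrals hold for a nonnegative size. *)
Lemma std_intS k (f : 'rV[R]_k.+1 -> R) (s : R) (q : {poly R}) :
  (forall t : R, 0 <= s - t ->
     std_int (s - t) (fun u : 'rV[R]_k => f (row_mx t%:M u)) = q.[t]) ->
  std_int s f = \int[lebesgue_measure]_(t in `[0, s]) q.[t].
Proof.
move=> fE; apply: eq_Rintegral => t.
by rewrite inE /= in_itv /= -(subr_ge0 t) => /andP[_ /fE].
Qed.

Let linear_std_int k s := forall (c : R) (f g : 'rV[R]_k -> R),
  polyfun f -> polyfun g ->
  std_int s (fun x => c * f x + g x) = c * std_int s f + std_int s g.

Let linear_std_int_sum k s (I : Type) (r : seq I) (c : I -> R)
    (g : I -> 'rV[R]_k -> R) :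
  linear_std_int k s -> (forall i, polyfun (g i)) ->
  std_int s (fun x => \sum_(i <- r) c i * g i x)
  = \sum_(i <- r) c i * std_int s (g i).
Proof.
move=> lin pg; elim: r => [|i r IHr].
  rewrite big_nil; under eq_fun do rewrite big_nil.
  (* The integral I of zero satisfies I = - I + I, hence vanishes. *)
  have := lin (-1) (fun=> 0) (fun=> 0) (polyfun_cst 0) (polyfun_cst 0).
  by under eq_fun do rewrite mulr0 addr0; rewrite mulN1r addNr.
rewrite big_cons -IHr -lin //; first by under eq_fun do rewrite big_cons.
by apply: polyfun_sum => j; apply: polyfunM => //; exact: polyfun_cst.
Qed.

(** The two claims are proved in one induction. Linearity in dimension k + 1 needs the inner
    integrals to be polynomial in t, hence integrable; polynomiality needs linearity in dimension k
    to integrate the expansion of [f] term by term. *)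
Lemma std_int_polyfun k :
  (forall s : R, 0 <= s -> linear_std_int k s) /\
  (forall f : 'rV[R]_k -> R, polyfun f ->
     exists p : {poly R}, forall s : R, 0 <= s -> std_int s f = p.[s]).
Proof.
elim: k => [|k [lin poly]].
  by split=> // f _; exists (f 0)%:P => s _; rewrite hornerC.
(* The slice at height t is a simplex of size s - t, whence the composition with s - X. *)
have step (f : 'rV[R]_k.+1 -> R) : polyfun f ->
    exists (I : finType) (e : I -> nat) (p : I -> {poly R}),
    forall s t : R, 0 <= s - t ->
      std_int (s - t) (fun u : 'rV[R]_k => f (row_mx t%:M u))
      = (\sum_i 'X^(e i) * (p i \Po (s%:P - 'X))).[t].
  move=> /polyfun_expand[I [e [g [pg fE]]]].
  have /fin_all_exists[p pE] i := poly _ (pg i).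
  exists I, e, p => s t st; under eq_fun do rewrite fE.
  rewrite linear_std_int_sum //; last exact: lin.
  rewrite horner_sum; apply: eq_bigr => i _.
  by rewrite pE // hornerM horner_comp !hornerE.
split=> [s s_ge0 c f g pf pg|f pf].
  have [I [e [p fE]]] := step _ pf; have [J [e' [q gE]]] := step _ pg.
  rewrite (std_intS (fE s)) (std_intS (gE s)).
  rewrite -Rintegral_hornerZ -Rintegral_hornerD; apply: std_intS => t st.
  by rewrite hornerD hornerZ -fE // -gE // lin //; exact: polyfun_slice.
have [I [e [p fE]]] := step _ pf.
(* Each monomial X^e (s - X)^j of the inner integral contributes its beta integral, a multiple of
   s^(e + j + 1). *)
exists (\sum_i \sum_(j < size (p i))
  ((p i)`_j * ((e i)`!%:R * j`!%:R / (e i + j).+1`!%:R)) *: 'X^((e i + j).+1)).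
move=> s s_ge0; rewrite (std_intS (fE s)) Rintegral_horner_sum.
rewrite horner_sum; apply: eq_bigr => i _.
rewrite comp_polyE mulr_sumr Rintegral_horner_sum horner_sum.
apply: eq_bigr => j _; rewrite -scalerAr Rintegral_hornerZ Rintegral_beta //.
by rewrite [LHS]mulrA hornerZ hornerXn.
Qed.

Lemma std_int_ge0 k (s : R) (f : 'rV[R]_k -> R) :
  (forall x, 0 <= f x) -> 0 <= std_int s f.
Proof.
elim: k s f => [|k IHk] s f f_ge0 //=.
by apply: Rintegral_ge0 => t _; exact: IHk.
Qed.

Lemma std_int_lin k (s c : R) (f g : 'rV[R]_k -> R) : 0 <= s ->
  polyfun f -> polyfun g ->
  std_int s (fun x => c * f x + g x) = c * std_int s f + std_int s g.
Proof. by move=> s_ge0; apply: (std_int_polyfun k).1. Qed.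

Lemma std_int_sum k (s : R) (I : Type) (r : seq I) (c : I -> R)
    (g : I -> 'rV[R]_k -> R) : 0 <= s -> (forall i, polyfun (g i)) ->
  std_int s (fun x => \sum_(i <- r) c i * g i x)
  = \sum_(i <- r) c i * std_int s (g i).
Proof.
by move=> s_ge0; apply: linear_std_int_sum; apply: (std_int_polyfun k).1.
Qed.

Lemma std_int_cst k (s c : R) : 0 <= s ->
  std_int s (fun _ : 'rV[R]_k => c) = c * s ^+ k / k`!%:R.
Proof.
have nz n : n`!%:R != 0 :> R by rewrite pnatr_eq0 -lt0n fact_gt0.
elim: k s => [|k IHk] s s_ge0; first by rewrite /= expr0 divr1 mulr1.
rewrite (@std_intS _ _ _ ((c / k`!%:R) *: ('X^0 * (s%:P - 'X) ^+ k))).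
  rewrite Rintegral_hornerZ Rintegral_beta // add0n mul1r.
  by field; rewrite !nz.
by move=> t st; rewrite IHk // !hornerE /=; field.
Qed.

(** All coordinates give the same value, though the iterated integral singles out the first: that
    one is a beta integral with e = 1, the others come from the induction hypothesis on slices. *)
Lemma std_int_coord k (s : R) (i : 'I_k) : 0 <= s ->
  std_int s (fun x : 'rV[R]_k => x 0 i) = s ^+ k.+1 / k.+1`!%:R.
Proof.
have nz n : n`!%:R != 0 :> R by rewrite pnatr_eq0 -lt0n fact_gt0.
elim: k s i => [|k IHk] s i s_ge0; first by case: i.
have [j ->|j ->] := @split_ordP 1 k i.
  rewrite (@std_intS _ _ _ (k`!%:R^-1 *: ('X^1 * (s%:P - 'X) ^+ k))).
    rewrite Rintegral_hornerZ Rintegral_beta // add1n mul1r.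
    by field; rewrite !nz.
  move=> t st; under eq_fun do rewrite row_scalar_mxEl.
  by rewrite std_int_cst // !hornerE /=; field.
rewrite (@std_intS _ _ _ (k.+1`!%:R^-1 *: ('X^0 * (s%:P - 'X) ^+ k.+1))).
  rewrite Rintegral_hornerZ Rintegral_beta // add0n mul1r.
  by field; rewrite !nz.
move=> t st; under eq_fun do rewrite row_scalar_mxEr.
by rewrite IHk // !hornerE /=; field.
Qed.

End PolyfunTheory.

(** * Gram determinants *)

Section Gram.
Variable R : realType.

(** For square [X] the Gram determinant is the square of the determinant. The equation [k = d] is a
    hypothesis because [edges_mx] has [#|S|.-1] rows, which is not convertible to [d]. *)
Lemma gram_gt0 k d (X : 'M[R]_(k, d)) : k = d -> row_free X ->
  0 < \det (X *m X^T).
Proof.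
move=> kd; subst k; rewrite row_free_unit unitmxE unitfE det_mulmx det_tr => X0.
by rewrite -expr2 exprn_even_gt0.
Qed.

(* Multiply [col_mx X w] by the transpose of [col_mx X n], whose own Gram
   matrix is block diagonal. *)
Lemma gram_height m d (X : 'M[R]_(m, d)) (w n : 'rV[R]_d) :
  (m + 1)%N = d -> X *m n^T = 0 -> n *m n^T = 1%:M ->
  row_free (col_mx X w) ->
  \det (col_mx X w *m (col_mx X w)^T)
  = \det (X *m X^T) * (w *m n^T) 0 0 ^+ 2.
Proof.
move=> md; subst d => Xn nn Qfree.
have nX : n *m X^T = 0 by rewrite -[n]trmxK -trmx_mul Xn trmx0.
set Q := col_mx X w in Qfree *; pose N := col_mx X n.
(* In a vanishing combination of the rows of [N], multiplying by the transpose of [n] kills the last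
   coefficient; the others vanish because the rows of [X] are among those of the free matrix [Q]. *)
have Nfree : \det N != 0.
  rewrite -unitfE -unitmxE -row_free_unit -kermx_eq0; apply/eqP.
  apply/row_matrixP => i; rewrite row0.
  have : row i (kermx N) *m N = 0 by apply/sub_kermxP; exact: row_sub.
  move: (row i _) => u; rewrite -[u]hsubmxK mul_row_col => uN0.
  have r0 : rsubmx u = 0.
    have := congr1 (mulmx^~ n^T) uN0.
    by rewrite mulmxDl -!mulmxA Xn nn mulmx0 add0r mulmx1 mul0mx.
  have l0 : lsubmx u = 0.
    move: uN0; rewrite r0 mul0mx addr0 => uX0.
    have : row_mx (lsubmx u) 0 *m Q = 0 *m Q.
      by rewrite mul_row_col uX0 !mul0mx addr0.
    by move/(row_free_inj Qfree); rewrite -row_mx0 => /eq_row_mx[].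
  by rewrite r0 l0 row_mx0.
have NN : \det N ^+ 2 = \det (X *m X^T).
  rewrite expr2 -{2}det_tr -det_mulmx tr_col_mx mul_col_row Xn nX nn.
  by rewrite det_lblock det1 mulr1.
have QN : \det Q * \det N = \det (X *m X^T) * (w *m n^T) 0 0.
  rewrite -(det_tr N) -det_mulmx tr_col_mx mul_col_row Xn det_lblock.
  by rewrite det_mx11.
have G0 : \det (X *m X^T) != 0 by rewrite -NN expf_neq0.
apply: (mulfI G0); rewrite mulrA -expr2 -exprMn -QN exprMn NN mulrC.
by rewrite det_mulmx det_tr -expr2.
Qed.

(** Integer coefficients make a change between two edge bases unimodular, so that Gram determinants
    do not depend on the order of the vertices or on the base point. *)
Definition int_span k d (X : 'M[R]_(k, d)) (u : 'rV[R]_d) : Prop :=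
  exists c : 'rV[int]_k, u = map_mx intr c *m X.

Lemma int_spanB k d (X : 'M[R]_(k, d)) u v :
  int_span X u -> int_span X v -> int_span X (u - v).
Proof.
move=> [c ->] [e ->]; exists (c - e).
by rewrite map_mxB mulmxBl.
Qed.

Lemma int_span_row k d (X : 'M[R]_(k, d)) i : int_span X (row i X).
Proof.
by exists (delta_mx 0 i); rewrite map_delta_mx rowE.
Qed.

Lemma int_span0 k d (X : 'M[R]_(k, d)) : int_span X 0.
Proof. by exists 0; rewrite map_mx0 mul0mx. Qed.

Lemma int_span_mx k l d (X : 'M[R]_(k, d)) (Y : 'M[R]_(l, d)) :
  (forall i, int_span X (row i Y)) ->
  exists L : 'M[int]_(l, k), Y = map_mx intr L *m X.
Proof.
move=> /fin_all_exists[c cE]; exists (\matrix_i c i).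
apply/row_matrixP => i; rewrite row_mul cE; congr (_ *m _).
by apply/rowP => j; rewrite !mxE.
Qed.

(** The two integer transition matrices are mutually inverse, so their determinants are units of the
    integers and have square 1. *)
Lemma gram_unimodular k l d (X : 'M[R]_(k, d)) (Y : 'M[R]_(l, d)) : k = l ->
  (forall i, int_span X (row i Y)) -> (forall i, int_span Y (row i X)) ->
  row_free X -> \det (X *m X^T) = \det (Y *m Y^T).
Proof.
move=> kl; subst l => /int_span_mx[L YE] /int_span_mx[L' XE] Xfree.
have LL : map_mx intr L' *m map_mx intr L = 1%:M :> 'M[R]_k.
  by apply: (row_free_inj Xfree); rewrite mul1mx -mulmxA -YE -XE.
have L2 : \det L ^+ 2 = 1.
  have : \det L \is a GRing.unit.
    have LL1 : \det L' * \det L = 1.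
      apply: (@intr_inj R).
      by rewrite intrM -!det_map_mx -det_mulmx LL det1.
    by apply/unitrP; exists (\det L'); rewrite (mulrC (\det L)).
  by case/orP => /eqP->.
rewrite YE trmx_mul -mulmxA (mulmxA X) !det_mulmx det_tr det_map_mx.
by rewrite mulrCA -expr2 -rmorphXn L2 mulr1.
Qed.

End Gram.

(** * Simplices and their edges *)

Section Dot.
Variables (R : realType) (n : nat).
Implicit Types u v w : 'rV[R]_n.

Lemma dotE u v : dot u v = (u *m v^T) 0 0.
Proof. by rewrite mxE; apply: eq_bigr => i _; rewrite mxE. Qed.

Lemma dotC u v : dot u v = dot v u.
Proof. by apply: eq_bigr => i _; rewrite mulrC. Qed.

Lemma dotDl u v w : dot (u + v) w = dot u w + dot v w.
Proof. by rewrite !dotE mulmxDl mxE. Qed.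

Lemma dotDr u v w : dot w (u + v) = dot w u + dot w v.
Proof. by rewrite !(dotC w) dotDl. Qed.

Lemma dotZl c u w : dot (c *: u) w = c * dot u w.
Proof. by rewrite !dotE -scalemxAl mxE. Qed.

Lemma dotZr c u w : dot w (c *: u) = c * dot w u.
Proof. by rewrite !(dotC w) dotZl. Qed.

Lemma dotNl u w : dot (- u) w = - dot u w.
Proof. by rewrite -scaleN1r dotZl mulN1r. Qed.

Lemma dotNr u w : dot w (- u) = - dot w u.
Proof. by rewrite !(dotC w) dotNl. Qed.

Lemma dotBl u v w : dot (u - v) w = dot u w - dot v w.
Proof. by rewrite dotDl dotNl. Qed.

Lemma dotBr u v w : dot w (u - v) = dot w u - dot w v.
Proof. by rewrite dotDr dotNr. Qed.

Lemma dot0l w : dot 0 w = 0.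
Proof. by rewrite dotE mul0mx mxE. Qed.

Lemma dot0r w : dot w 0 = 0.
Proof. by rewrite dotC dot0l. Qed.

Lemma dot_sumr I (r : seq I) P (F : I -> 'rV[R]_n) u :
  dot u (\sum_(i <- r | P i) F i) = \sum_(i <- r | P i) dot u (F i).
Proof. exact: (big_morph (dot u) (fun v w => dotDr v w u) (dot0r u)). Qed.

Lemma dot_suml I (r : seq I) P (F : I -> 'rV[R]_n) u :
  dot (\sum_(i <- r | P i) F i) u = \sum_(i <- r | P i) dot (F i) u.
Proof. by rewrite dotC dot_sumr; apply: eq_bigr => i _; exact: dotC. Qed.

Lemma dot_ge0 u : 0 <= dot u u.
Proof. by apply: sumr_ge0 => i _; rewrite -expr2 sqr_ge0. Qed.

Lemma polyfun_dot k (f g : 'rV[R]_k -> 'rV[R]_n) :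
  (forall i, polyfun (fun x => f x 0 i)) ->
  (forall i, polyfun (fun x => g x 0 i)) ->
  polyfun (fun x => dot (f x) (g x)).
Proof. by move=> pf pg; apply: polyfun_sum => i; exact: polyfunM. Qed.

End Dot.

Section Simplex.
Variables (R : realType) (d : nat) (M : mesh R d).
Implicit Types S T E : {set 'I_(nv M)}.
Local Notation p := (vtx M).

Lemma size_verts S : size (verts S) = #|S|.
Proof. by rewrite size_map -cardE. Qed.

Lemma nth_verts S k : (k < #|S|)%N -> exists2 i, i \in S & (verts S)`_k = p i.
Proof.
move=> kS; have : (verts S)`_k \in verts S by rewrite mem_nth ?size_verts.
by case/mapP=> i; rewrite mem_enum; exists i.
Qed.

Lemma vtxP S i : i \in S -> exists2 k, (k < #|S|)%N & p i = (verts S)`_k.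
Proof.
rewrite -mem_enum => iS; exists (index i (enum S)).
  by rewrite cardE index_mem.
by rewrite (nth_map i) ?index_mem // nth_index.
Qed.

Lemma edges_mx_row S k : row k (edges_mx S) = (verts S)`_k.+1 - (verts S)`_0.
Proof. by apply/rowP => j; rewrite !mxE. Qed.

Lemma edge_row S (k : 'I_(#|S|.-1)) :
  exists i j, [/\ i \in S, j \in S & row k (edges_mx S) = p i - p j].
Proof.
have kS : (k.+1 < #|S|)%N by have := ltn_ord k; rewrite ltn_predRL.
have [i iS iE] := nth_verts kS.
have [j jS jE] := nth_verts (leq_ltn_trans (leq0n _) kS).
by exists i, j; rewrite edges_mx_row iE jE.
Qed.

(** The rows of [edges_mx] all start at the vertex of index 0; any other edge is a difference of two
    of them. *)
Lemma int_span_edge S i j : i \in S -> j \in S ->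
  int_span (edges_mx S) (p i - p j).
Proof.
have base k : k \in S -> int_span (edges_mx S) (p k - (verts S)`_0).
  case/vtxP=> -[|l] lS ->; first by rewrite subrr; exact: int_span0.
  have lS' : (l < #|S|.-1)%N by rewrite ltn_predRL.
  by rewrite -(edges_mx_row (Ordinal lS')); exact: int_span_row.
move=> iS jS; have := int_spanB (base _ iS) (base _ jS).
by rewrite opprB addrA subrK.
Qed.

Lemma sum_verts (V : nmodType) S (F : 'rV[R]_d -> V) :
  \sum_(i in S) F (p i) = \sum_(k < #|S|) F (verts S)`_k.
Proof.
rewrite -[LHS]big_enum -(big_map p predT F) -/(verts S) (big_nth 0) size_verts.
by rewrite big_mkord.
Qed.

(** Translates combinations of edges, as in [edges_mx], into combinations of vertices with zero
    total weight, as in [aff_indep]. *)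
Lemma edges_comb S (u : 'rV[R]_(#|S|.-1)) : (0 < #|S|)%N ->
  exists l : 'I_(nv M) -> R,
    [/\ forall i, i \notin S -> l i = 0, \sum_i l i = 0,
        \sum_i l i *: p i = u *m edges_mx S & (forall i, l i = 0) -> u = 0].
Proof.
move=> S_gt0.
(* Coefficients in the order of [enum S]: the base vertex receives minus the sum of the others.
   Outside [S] the index runs past the end of [c], and the default 0 is read. *)
pose c := - (\sum_k u 0 k) :: [seq u 0 k | k <- enum 'I_(#|S|.-1)].
pose l i := c`_(index i (enum S)).
have size_c : size c = #|S| by rewrite /= size_map size_enum_ord prednK.
have cS (k : 'I_(#|S|.-1)) : c`_k.+1 = u 0 k.
  by rewrite /= (nth_map k) ?size_enum_ord // nth_ord_enum.
have lnth x0 k : (k < #|S|)%N -> l (nth x0 (enum S) k) = c`_k.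
  by move=> kS; rewrite /l index_uniq -?cardE ?enum_uniq.
have l0 i : i \notin S -> l i = 0.
  rewrite -mem_enum => iS; rewrite /l nth_default // size_c cardE.
  by rewrite leqNgt index_mem.
have sumE (V : nmodType) (F : R -> 'rV[R]_d -> V) : (forall x, F 0 x = 0) ->
    \sum_i F (l i) (p i)
    = F c`_0 (verts S)`_0 + \sum_(k < #|S|.-1) F (u 0 k) (verts S)`_k.+1.
  move=> F0; have [i0 i0S] : exists i, i \in S by apply/card_gt0P.
  rewrite (bigID [in S]) /= [X in _ + X]big1 ?addr0; last first.
    by move=> i /l0->; rewrite F0.
  rewrite -[LHS]big_enum (big_nth i0) -cardE big_mkord.
  transitivity (\sum_(k < #|S|) F c`_k (verts S)`_k).
    apply: eq_bigr => k _; rewrite lnth // (nth_map i0) // -cardE.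
    exact: ltn_ord.
  rewrite -(big_mkord predT (fun k => F c`_k (verts S)`_k)).
  rewrite -{1}(prednK S_gt0) big_nat_recl // big_mkord; congr (_ + _).
  by apply: eq_bigr => k _; rewrite -cS.
exists l; split => //.
- by rewrite (sumE _ (fun a _ => a)) // addNr.
- rewrite (sumE _ (fun a x => a *: x)) => [|x]; last by rewrite scale0r.
  rewrite mulmx_sum_row /= scaleNr scaler_suml addrC -sumrB.
  by apply: eq_bigr => k _; rewrite edges_mx_row scalerBr.
- move=> l_eq0; apply/rowP => k; rewrite mxE -cS.
  have kS : (k.+1 < #|S|)%N by have := ltn_ord k; rewrite ltn_predRL.
  have [i0 i0S] : exists i, i \in S by apply/card_gt0P.
  by rewrite -(lnth i0) // l_eq0.
Qed.

Lemma aff_indep_row_free S : (0 < #|S|)%N -> aff_indep S ->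
  row_free (edges_mx S).
Proof.
move=> S_gt0 indep; rewrite -kermx_eq0; apply/eqP/row_matrixP => i.
rewrite row0; have : row i (kermx (edges_mx S)) *m edges_mx S = 0.
  by apply/sub_kermxP; exact: row_sub.
move: (row i _) => u uX0; have [l [l0 suml lE uE]] := edges_comb u S_gt0.
by apply: uE => j; apply: indep => //; rewrite lE.
Qed.

(** * Edges and barycentric coordinates of a cell *)

Section Cell.
Variable T : {set 'I_(nv M)}.
Hypotheses (cardT : #|T| = d.+1) (indepT : aff_indep T).

Let T_gt0 : (0 < #|T|)%N. Proof. by rewrite cardT. Qed.

Lemma cell_row_full : row_full (edges_mx T).
Proof.
have := aff_indep_row_free T_gt0 indepT.
by rewrite /row_free /row_full => /eqP->; rewrite cardT.
Qed.

(** The edges of a cell span the whole space, so linear identities can be tested on them. *)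
Lemma edges_ext n (A B : 'M[R]_(d, n)) :
  (forall i j, i \in T -> j \in T -> (p i - p j) *m A = (p i - p j) *m B) ->
  A = B.
Proof.
move=> AB; have [X XE] := row_fullP cell_row_full.
rewrite -[A]mul1mx -[B]mul1mx -XE -!mulmxA; congr (_ *m _).
apply/row_matrixP => k; rewrite !row_mul.
by have [i [j [iT jT ->]]] := edge_row k; exact: AB.
Qed.

Lemma dot_edges_ext (u v : 'rV[R]_d) :
  (forall i j, i \in T -> j \in T -> dot u (p i - p j) = dot v (p i - p j)) ->
  u = v.
Proof.
move=> uv; apply: trmx_inj; apply: edges_ext => i j iT jT.
by apply/rowP => k; rewrite ord1 -!dotE !(dotC (_ - _)) uv.
Qed.

(** Expand x - p k in the edges and add weight 1 at [k]. The coefficients carry no sign, since [x]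
    may lie outside the cell. *)
Lemma barycentric (x : 'rV[R]_d) : exists l : 'I_(nv M) -> R,
  [/\ forall i, i \notin T -> l i = 0, \sum_i l i = 1 &
      x = \sum_i l i *: p i].
Proof.
have [k kT] : exists k, k \in T by apply/card_gt0P.
have [X XE] := row_fullP cell_row_full.
have [l [l0 suml lE _]] := edges_comb ((x - p k) *m X) T_gt0.
exists (fun i => (i == k)%:R + l i); split=> [i iT||].
- by rewrite l0 // addr0; case: eqP iT kT => // -> /negPf->.
- rewrite big_split /= suml addr0 (bigD1 k) //= eqxx big1 ?addr0 //.
  by move=> i /negPf->.
- under eq_bigr do rewrite scalerDl; rewrite big_split /= lE -mulmxA XE mulmx1.
  rewrite (bigD1 k) //= eqxx scale1r big1 ?addr0; last first.
    by move=> i /negPf->; rewrite scale0r.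
  by rewrite addrC subrK.
Qed.

End Cell.

End Simplex.

(** * Surface integrals and volumes *)

Section SurfaceIntegral.
Variables (R : realType) (d : nat) (M : mesh R d).
Implicit Types S T E : {set 'I_(nv M)}.
Implicit Types f g : 'rV[R]_d -> R.
Local Notation p := (vtx M).

(** The measure in the dimension of the simplex itself: the area of a face as well as the volume of
    a cell. *)
Definition vol S : R := sint S (fun=> 1).

Lemma sint_lin S c f g : polyfun f -> polyfun g ->
  sint S (fun x => c * f x + g x) = c * sint S f + sint S g.
Proof.
move=> pf pg; rewrite /sint std_int_lin ?mulrDr //; last 2 first.
- exact: (polyfun_affine _ _ pf).
- exact: (polyfun_affine _ _ pg).
by rewrite mulrCA.
Qed.

Lemma sintD S f g : polyfun f -> polyfun g ->
  sint S (fun x => f x + g x) = sint S f + sint S g.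
Proof.
move=> pf pg; have := sint_lin S 1 pf pg.
by under eq_fun do rewrite mul1r; rewrite mul1r.
Qed.

Lemma sintB S f g : polyfun f -> polyfun g ->
  sint S (fun x => f x - g x) = sint S f - sint S g.
Proof.
move=> pf pg; have := sint_lin S (-1) pg pf.
by under eq_fun do rewrite mulN1r addrC; rewrite mulN1r addrC.
Qed.

Lemma sint_sum S (I : Type) (r : seq I) (c : I -> R) (g : I -> 'rV[R]_d -> R) :
  (forall i, polyfun (g i)) ->
  sint S (fun x => \sum_(i <- r) c i * g i x)
  = \sum_(i <- r) c i * sint S (g i).
Proof.
move=> pg; rewrite /sint.
rewrite (@std_int_sum _ _ _ _ _ _
  (fun i t => g i ((verts S)`_0 + t *m edges_mx S))) //; last first.
  by move=> i; apply: polyfun_affine.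
by rewrite mulr_sumr; apply: eq_bigr => i _; rewrite mulrCA.
Qed.

Lemma sint_ge0 S f : (forall x, 0 <= f x) -> 0 <= sint S f.
Proof. by move=> f_ge0; rewrite mulr_ge0 ?sqrtr_ge0 ?std_int_ge0. Qed.

Lemma volE S :
  vol S = Num.sqrt (\det (edges_mx S *m (edges_mx S)^T)) / (#|S|.-1)`!%:R.
Proof. by rewrite /vol /sint std_int_cst ?expr1n ?mul1r. Qed.

Lemma sint_cst S c : sint S (fun=> c) = c * vol S.
Proof.
by rewrite volE /sint std_int_cst ?expr1n ?mulr1 // mulrCA.
Qed.

(** The vertex rule is exact on affine functions: on the reference simplex of dimension k a constant
    c gives c / k! and each coordinate gives 1 / (k + 1)!, so every vertex weighs 1 / (k + 1). *)
Lemma sint_affine S (a : 'rV[R]_d) (c : R) : (0 < #|S|)%N ->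
  sint S (fun x => dot a x + c)
  = vol S * (#|S|%:R^-1 * \sum_(i in S) (dot a (p i) + c)).
Proof.
move=> S_gt0; set k := #|S|.-1; have kE : #|S| = k.+1 by rewrite prednK.
pose v0 := (verts S)`_0; pose b (j : 'I_k) := dot a (row j (edges_mx S)).
have -> : \sum_(i in S) (dot a (p i) + c)
    = k.+1%:R * (dot a v0 + c) + \sum_j b j.
  rewrite (@sum_verts R d M _ S (fun x => dot a x + c)).
  rewrite -(big_mkord predT (fun j => dot a (verts S)`_j + c)) kE.
  rewrite big_nat_recl // big_mkord -/v0.
  have -> : \sum_(j < k) (dot a (verts S)`_j.+1 + c)
      = \sum_(j < k) ((dot a v0 + c) + b j).
    by apply: eq_bigr => j _; rewrite /b edges_mx_row dotBr -/v0; ring.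
  rewrite big_split /= sumr_const card_ord addrA; congr (_ + _).
  by rewrite -mulr_natl -natr1; ring.
have -> : sint S (fun x => dot a x + c)
    = Num.sqrt (\det (edges_mx S *m (edges_mx S)^T)) *
      ((dot a v0 + c) / k`!%:R + (\sum_j b j) / k.+1`!%:R).
  rewrite /sint; congr (_ * _).
  rewrite (_ : (fun t => _) = (fun t : 'rV[R]_k =>
     1 * (\sum_j b j * t 0 j) + (dot a v0 + c))); last first.
    apply/funext => t; rewrite dotDr mulmx_sum_row dot_sumr mul1r.
    rewrite -/v0 addrAC addrC; congr (_ + _).
    by apply: eq_bigr => j _; rewrite dotZr mulrC.
  rewrite std_int_lin //; last 2 first.
  - apply: polyfun_sum => j.
    by apply: polyfunM; [exact: polyfun_cst | exact: polyfun_coord].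
  - exact: polyfun_cst.
  rewrite std_int_cst // expr1n mulr1 mul1r addrC; congr (_ + _).
  rewrite (@std_int_sum _ _ _ _ _ b (fun j (t : 'rV[R]_k) => t 0 j)) //.
    rewrite mulr_suml; apply: eq_bigr => j _.
    by rewrite std_int_coord // expr1n mul1r.
  by move=> j; exact: polyfun_coord.
rewrite volE -/k kE factS natrM.
by field; rewrite pnatr_eq0 -lt0n fact_gt0 nat1r pnatr_eq0.
Qed.

Lemma sint_dot_cst n S (c : 'rV[R]_n) (f : 'rV[R]_d -> 'rV[R]_n) :
  (forall i, polyfun (fun x => f x 0 i)) ->
  sint S (fun x => dot c (f x)) = \sum_i c 0 i * sint S (fun x => f x 0 i).
Proof. exact: sint_sum. Qed.

(** The form in which the mean conditions of [VCR] and [Zspace] are used. Positivity of the measure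
    turns a zero mean into a zero integral, as [P0] divides by it. *)
Lemma sint_dot_P0_eq0 n S (c : 'rV[R]_n) (f : 'rV[R]_d -> 'rV[R]_n) :
  (forall i, polyfun (fun x => f x 0 i)) -> 0 < vol S -> P0 S f = 0 ->
  sint S (fun x => dot c (f x)) = 0.
Proof.
move=> pf S_gt0 /rowP P0f; rewrite sint_dot_cst // big1 // => i _.
have := P0f i; rewrite !mxE -/(vol S) => /eqP.
by rewrite mulf_eq0 invr_eq0 (gt_eqF S_gt0) => /eqP->; rewrite mulr0.
Qed.

(** * Volume of a cell from a facet and its height *)

Section FaceHeight.
Variables (T : {set 'I_(nv M)}) (i k : 'I_(nv M)) (n : 'rV[R]_d).
Hypotheses (cardT : #|T| = d.+1) (indepT : aff_indep T).
Hypotheses (iT : i \in T) (kE : k \in (T :\ i)%SET).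
Hypotheses (nn : dot n n = 1).
Hypotheses (nE : forall a b, a \in (T :\ i)%SET -> b \in (T :\ i)%SET ->
  dot n (p a - p b) = 0).
Local Notation E := (T :\ i)%SET.

Let cardE : #|E| = d.
Proof. by have := cardsD1 i T; rewrite iT cardT add1n => -[]. Qed.

Let E_gt0 : (0 < #|E|)%N.
Proof. by apply/card_gt0P; exists k. Qed.

Let Tfree : row_free (edges_mx T).
Proof. by apply: aff_indep_row_free; rewrite // cardT. Qed.

(** The edges of the facet together with p i - p k form another integer basis of the edges of [T];
    [gram_height] then splits off the height. *)
Lemma gram_face : \det (edges_mx T *m (edges_mx T)^T)
  = \det (edges_mx E *m (edges_mx E)^T) * dot n (p i - p k) ^+ 2.
Proof.
pose Q := col_mx (edges_mx E) (p i - p k).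
have ET a : a \in E -> a \in T by rewrite inE => /andP[].
have TQ a : int_span (edges_mx T) (row a Q).
  rewrite -[a](@splitK (#|E|.-1) 1); case: (fintype.split a) => b /=.
    rewrite rowKu; have [u [v [uE vE ->]]] := edge_row b.
    by apply: int_span_edge; exact: ET.
  by rewrite rowKd [b]ord1 row_id; apply: int_span_edge => //; exact: ET.
have baseQ a : a \in T -> int_span Q (p a - p k).
  move=> aT; have [->|ai] := eqVneq a i.
    by have := int_span_row Q (rshift _ 0); rewrite rowKd row_id.
  have [|c ->] := @int_span_edge _ _ M E a k _ kE; first by rewrite !inE ai.
  by exists (row_mx c 0); rewrite map_row_mx mul_row_col map_mx0 mul0mx addr0.
have QT a : int_span Q (row a (edges_mx T)).
  have [u [v [uT vT ->]]] := edge_row a.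
  have := int_spanB (baseQ _ uT) (baseQ _ vT).
  by rewrite opprB addrA subrK.
have cardQ : #|T|.-1 = (#|E|.-1 + 1)%N by rewrite addn1 prednK // cardT cardE.
rewrite (@gram_unimodular _ _ _ _ _ Q) //.
rewrite (@gram_height _ _ _ _ _ n) -?dotE 1?dotC //.
- by rewrite addn1 prednK // cardE.
- apply/row_matrixP => a; rewrite row_mul row0.
  have [u [v [uE vE ->]]] := edge_row a.
  by apply/rowP => b; rewrite ord1 -dotE dotC nE // mxE.
- by apply/rowP => b; rewrite ord1 -dotE nn mxE.
(* [Q] has full rank because the free matrix [edges_mx T] factors through it. *)
- have [L LE] := int_span_mx QT; rewrite -row_leq_rank.
  have rT : \rank (edges_mx T) = (#|E|.-1 + 1)%N.
    by rewrite -cardQ; apply/eqP; exact: Tfree.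
  by rewrite -[X in (X <= _)%N]rT {1}LE mxrankM_maxr.
Qed.

Let gramT_gt0 : 0 < \det (edges_mx T *m (edges_mx T)^T).
Proof. by apply: gram_gt0 => //; rewrite cardT. Qed.

(** The edge matrix of a facet is not square, so positivity is inherited from [T]: by [gram_face]
    the positive determinant of [T] is this one times a square. *)
Let gramE_gt0 : 0 < \det (edges_mx E *m (edges_mx E)^T).
Proof.
have := gramT_gt0; rewrite gram_face => g_gt0.
have h_ge0 := sqr_ge0 (dot n (p i - p k)).
have [h0|h_neq0] := eqVneq (dot n (p i - p k) ^+ 2) 0.
  by move: g_gt0; rewrite h0 mulr0 ltxx.
by move: g_gt0; rewrite pmulr_lgt0 // lt_def h_neq0.
Qed.

Lemma vol_face_gt0 : 0 < vol E.
Proof. by rewrite volE divr_gt0 ?sqrtr_gt0 // ltr0n fact_gt0. Qed.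

(** Square root of [gram_face]; the factor d is the quotient of the factorials d! and (d - 1)! in
    [volE]. *)
Lemma vol_cell_face : d%:R * vol T = vol E * `|dot n (p i - p k)|.
Proof.
rewrite !volE gram_face sqrtrM ?ltW // sqrtr_sqr.
move: (Num.sqrt _) (`|_|) => g h; rewrite cardT cardE /=.
have := E_gt0; rewrite cardE; case: (d) => // e _; rewrite factS natrM /=.
by field; rewrite pnatr_eq0 -lt0n fact_gt0 nat1r pnatr_eq0.
Qed.

End FaceHeight.

End SurfaceIntegral.

(** * Cells sharing a face *)

Section Adjacency.
Variables (R : realType) (d : nat) (M : mesh R d).
Variables Omega GammaD GammaN : set 'rV[R]_d.
Hypothesis cm : conforming_mesh Omega GammaD GammaN M.
Implicit Types T E : {set 'I_(nv M)}.
Local Notation p := (vtx M).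

Lemma neighbor_vertex T E : #|E| = d -> T \in neighbors E ->
  exists i, [/\ i \in T, E = (T :\ i)%SET & (T :\: E)%SET = [set i]%SET].
Proof.
rewrite inE => cardE /andP[Tc ET].
have : #|(T :\: E)%SET| == 1%N.
  by rewrite cardsDS // (cm_cell_card cm) // cardE subSnn.
case/cards1P=> i TE; exists i.
have := set11 i; rewrite -TE inE => /andP[iE iT]; split=> //.
apply/setP => j; have := congr1 (fun A : {set _} => j \in A) TE.
rewrite !inE; have := fintype.subsetP ET j.
by case: (j \in E) => [->//|] ; case: (j \in T); case: (j == i) => // _.
Qed.

Definition face_orth E (n : 'rV[R]_d) :=
  forall a b, a \in E -> b \in E -> dot n (p a - p b) = 0.

(** The d - 1 edges cannot span the space. This provides a normal direction before [E] is known to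
    be a face of the mesh, when nothing is known about [normal M E]. *)
Lemma face_orth_exists E : #|E| = d -> (0 < d)%N ->
  exists2 n, n != 0 & face_orth E n.
Proof.
move=> cardE d_gt0; have : kermx (edges_mx E)^T != 0.
  rewrite kermx_eq0 -row_leq_rank mxrank_tr -ltnNge.
  by apply: leq_ltn_trans (rank_leq_row _) _; rewrite cardE prednK.
case/rowV0Pn=> n /sub_kermxP nX n0; exists n => // a b aE bE.
have [c ->] := int_span_edge aE bE.
by rewrite dotE trmx_mul mulmxA nX mul0mx mxE.
Qed.

(** Otherwise [n] would be orthogonal to every edge of the cell, hence zero. *)
Lemma face_height_neq0 T i j n : T \in cells M -> i \in T ->
  j \in (T :\ i)%SET -> n != 0 -> face_orth (T :\ i)%SET n ->
  dot n (p i - p j) != 0.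
Proof.
move=> Tc iT jE n0 nE; apply: contra_neq n0 => nij.
have [cardT indepT] := (cm_cell_card cm Tc, cm_cell_indep cm Tc).
have base a : a \in T -> dot n (p a - p j) = 0.
  move=> aT; have [->//|ai] := eqVneq a i.
  by apply: nE; rewrite // !inE ai.
apply: (dot_edges_ext cardT indepT) => a b aT bT; rewrite dot0l.
have -> : p a - p b = (p a - p j) - (p b - p j) by rewrite opprB addrA subrK.
by rewrite dotBr !base // subrr.
Qed.

Lemma sum_face_weight (V : lmodType R) E (t : R) (F : 'I_(nv M) -> V) :
  \sum_i (t * (i \in E)%:R) *: F i = t *: \sum_(i in E) F i.
Proof.
rewrite scaler_sumr [RHS]big_mkcond; apply: eq_bigr => i _.
by case: (i \in E); rewrite ?mulr1 // mulr0 scale0r.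
Qed.

(* A point of the segment from the barycentre of E to the vertex i1, close
   enough to E, lies in both cells but not on E. *)
Lemma same_side_eq T1 T2 i1 i2 j E n : T1 \in cells M -> T2 \in cells M ->
  i1 \in T1 -> i2 \in T2 -> E = (T1 :\ i1)%SET -> E = (T2 :\ i2)%SET ->
  j \in E -> face_orth E n ->
  0 < dot n (p i1 - p j) * dot n (p i2 - p j) -> T1 = T2.
Proof.
move=> T1c T2c i1T i2T E1 E2 jE nE same; apply/eqP.
have [card1 card2] := (cm_cell_card cm T1c, cm_cell_card cm T2c).
have cardE : #|E| = d.
  by have := cardsD1 i1 T1; rewrite i1T card1 add1n -E1 => -[].
have ET1 a : a \in E -> a \in T1 by rewrite E1 inE => /andP[].
have ET2 a : a \in E -> a \in T2 by rewrite E2 inE => /andP[].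
have i1E : i1 \notin E by rewrite E1 !inE eqxx.
have i2E : i2 \notin E by rewrite E2 !inE eqxx.
case: (eqVneq T1 T2) => [//|neqT].
have T12 : (T1 :&: T2)%SET = E.
  apply/esym/eqP; rewrite eqEcard; apply/andP; split.
    by apply/fintype.subsetP => a aE; rewrite inE ET1 ?ET2.
  rewrite cardE leqNgt; apply/negP => lt_d; case/eqP: neqT.
  transitivity (T1 :&: T2)%SET.
    by apply/esym/eqP; rewrite eqEcard subsetIl card1.
  by apply/eqP; rewrite eqEcard subsetIr card2.
(* The coefficient of [p i1] at [i2] is the quotient of the two heights over [E], positive for
   vertices on the same side. *)
have [l [l0 suml p1E]] := barycentric card2 (cm_cell_indep cm T2c) (p i1).
have s12 : dot n (p i1 - p j) = l i2 * dot n (p i2 - p j).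
  have -> : p i1 - p j = \sum_a l a *: (p a - p j).
    under eq_bigr do rewrite scalerBr; rewrite big_split /= sumrN -scaler_suml.
    by rewrite suml scale1r -p1E.
  rewrite dot_sumr (bigD1 i2) //= dotZr big1 ?addr0 // => a ai2.
  rewrite dotZr; have [aT2|aT2] := boolP (a \in T2); last by rewrite l0 ?mul0r.
  by rewrite nE ?mulr0 // E2 !inE ai2.
have s1_neq0 : dot n (p i1 - p j) != 0.
  by apply: contraTneq same => ->; rewrite mul0r ltxx.
have li2 : 0 < l i2.
  move: same; rewrite s12 -mulrA -expr2 pmulr_lgt0 //.
  rewrite lt_def sqr_ge0 andbT expf_neq0 //.
  by apply: contraNneq s1_neq0 => s2; rewrite s12 s2 mulr0.
(* The point [y] has weight t at [i1] and t B at each vertex of [E], and [t] makes the total 1.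
   Since B bounds every |l a|, the coefficients t l a + t B of [y] in [T2] are nonnegative on
   [E]. *)
pose B : R := \sum_a `|l a|.
have B_ge0 : 0 <= B by rewrite sumr_ge0.
pose t : R := (1 + d%:R * B)^-1.
have dB_gt0 : 0 < 1 + d%:R * B by rewrite ltr_wpDr // mulr_ge0.
have t_gt0 : 0 < t by rewrite invr_gt0.
have tB : t + t * B * d%:R = 1.
  by rewrite -mulrA (mulrC B) -{1}[t]mulr1 -mulrDr mulVf // gt_eqF.
pose y := t *: p i1 + (t * B) *: \sum_(a in E) p a.
have sumE (F : 'I_(nv M) -> R) : (forall a, a \in E -> F a = 1) ->
    \sum_(a in E) F a = d%:R.
  by move=> F1; rewrite (eq_bigr _ F1) sumr_const cardE.
have sumB (F : 'I_(nv M) -> R) : \sum_a F a = 1 ->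
    \sum_a (t * F a + t * B * (a \in E)%:R) = 1.
  move=> F1; rewrite big_split /= -!mulr_sumr F1 mulr1.
  have -> : \sum_a (a \in E)%:R = d%:R :> R.
    rewrite -(sumE (fun=> 1)) // [RHS]big_mkcond.
    by apply: eq_bigr => a _; case: ifP.
  exact: tB.
have sumP (F : 'I_(nv M) -> R) : p i1 = \sum_a F a *: p a ->
    y = \sum_a (t * F a + t * B * (a \in E)%:R) *: p a.
  move=> FE; under eq_bigr do rewrite scalerDl.
  rewrite big_split /= sum_face_weight; congr (_ + _).
  by rewrite FE scaler_sumr; apply: eq_bigr => a _; rewrite scalerA.
have y1 : simplex T1 y.
  exists (fun a => t * (a == i1)%:R + t * B * (a \in E)%:R); split.
  - by move=> a; rewrite addr_ge0 // !mulr_ge0 // ltW.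
  - move=> a aT1; rewrite (contraNF (@ET1 a)) // (_ : a == i1 = false).
      by rewrite !mulr0 addr0.
    by apply: contraNF aT1 => /eqP->.
  - apply: sumB; rewrite (bigD1 i1) //= eqxx big1 ?addr0 //.
    by move=> a /negPf->.
  - apply: sumP; rewrite (bigD1 i1) //= eqxx scale1r big1 ?addr0 //.
    by move=> a /negPf->; rewrite scale0r.
have y2 : simplex T2 y.
  exists (fun a => t * l a + t * B * (a \in E)%:R); split.
  - move=> a; have [aE|aE] := boolP (a \in E).
      rewrite mulr1 -mulrDr mulr_ge0 ?(ltW t_gt0) // -lerBlDl sub0r.
      apply: le_trans (_ : `|l a| <= _); first by rewrite -normrN ler_norm.
      by rewrite /B (bigD1 a) //= lerDl sumr_ge0.
    rewrite mulr0 addr0 mulr_ge0 ?(ltW t_gt0) //.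
    have [->|ai2] := eqVneq a i2; first exact: ltW.
    by rewrite l0 //; apply: contraNN aE => aT2; rewrite E2 !inE ai2.
  - move=> a aT2; rewrite l0 // (contraNF (@ET2 a)) //.
    by rewrite !mulr0 addr0.
  - exact: sumB.
  - exact: sumP.
(* By conformity [y] lies on [E] and has height 0, but its height is also t times the nonzero height
   of [i1]. *)
have : simplex E y by rewrite -T12 -(cm_conforming cm T1c T2c).
case=> m [m_ge0 m0 summ yE].
have : dot n (y - p j) = 0.
  have -> : y - p j = \sum_a m a *: (p a - p j).
    under eq_bigr do rewrite scalerBr; rewrite big_split /= sumrN -scaler_suml.
    by rewrite summ scale1r -yE.
  rewrite dot_sumr big1 // => a _; rewrite dotZr.
  have [aE|aE] := boolP (a \in E); last by rewrite m0 ?mul0r.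
  by rewrite nE ?mulr0.
have -> : y - p j = t *: (p i1 - p j) + (t * B) *: \sum_(a in E) (p a - p j).
  rewrite sumrB sumr_const cardE -scaler_nat !scalerBr scalerA addrACA -opprD.
  by rewrite -scalerDl tB scale1r.
rewrite dotDr !dotZr dot_sumr big1 ?mulr0 ?addr0 => [|a aE]; last exact: nE.
by move/eqP; rewrite mulf_eq0 (negPf s1_neq0) (gt_eqF t_gt0).
Qed.

Hypothesis d_gt0 : (0 < d)%N.

Lemma face_inh E : #|E| = d -> exists j, j \in E.
Proof. by move=> cardE; apply/card_gt0P; rewrite cardE. Qed.

(** The side of [E] on which the extra vertex lies determines the cell, by [same_side_eq], and there
    are two sides. *)
Lemma card_neighbors_le2 E : #|E| = d -> (#|neighbors E| <= 2)%N.
Proof.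
move=> cardE; have [j jE] := face_inh cardE.
have [n n0 nE] := face_orth_exists cardE d_gt0.
pose side T := [exists i in (T :\: E)%SET, 0 < dot n (p i - p j)].
have sideE T i : (T :\: E)%SET = [set i]%SET ->
    side T = (0 < dot n (p i - p j)).
  move=> TE; rewrite /side TE; apply/exists_inP/idP => [[a]|i_gt0].
    by rewrite inE => /eqP->.
  by exists i; rewrite ?inE.
rewrite -(@card_in_imset _ _ side); first by rewrite -card_bool max_card.
move=> T1 T2 T1n T2n.
have [[i1 [i1T E1 TE1]] [i2 [i2T E2 TE2]]] :=
  (neighbor_vertex cardE T1n, neighbor_vertex cardE T2n).
have [T1c T2c] : T1 \in cells M /\ T2 \in cells M.
  by move: T1n T2n; rewrite !inE => /andP[-> _] /andP[-> _].
have s1 : dot n (p i1 - p j) != 0.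
  by apply: (face_height_neq0 T1c i1T) => //; rewrite -E1.
have s2 : dot n (p i2 - p j) != 0.
  by apply: (face_height_neq0 T2c i2T) => //; rewrite -E2.
rewrite (sideE _ _ TE1) (sideE _ _ TE2) => s12.
apply: (same_side_eq T1c T2c i1T i2T E1 E2 jE nE).
move: s1 s2 s12; rewrite !lt0r => s1 s2; rewrite s1 s2 /= mulf_neq0 //=.
case: lerP => [s1_ge0 /esym s2_ge0|s1_lt0 /esym/negbT].
  by rewrite mulr_ge0.
by rewrite -ltNge => s2_lt0; rewrite mulr_le0 // ltW.
Qed.

(** * Orientation of the cells around a face *)

Section Face.
Variable E : {set 'I_(nv M)}.
Hypothesis Ef : E \in (faces_int M :|: faces_bd M)%SET.
Local Notation n := (normal M E).

Lemma card_face : #|E| = d.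
Proof. by move: Ef; rewrite !inE => /orP[] /andP[/eqP]. Qed.

Lemma dot_normal : dot n n = 1.
Proof.
have := cm_normal_unit cm Ef; rewrite /enorm => n1.
by rewrite -[LHS]sqr_sqrtr ?dot_ge0 // n1 expr1n.
Qed.

Lemma normal_orth : face_orth E n.
Proof. by move=> a b; exact: (cm_normal_orth cm Ef). Qed.

(** As the normal is orthogonal to [E], the sign at one vertex of [E] is the sign at all of them. *)
Lemma outwardE T i j : (T :\: E)%SET = [set i]%SET -> j \in E ->
  outward T E = (dot n (p i - p j) < 0).
Proof.
move=> TE jE; rewrite /outward TE; apply/forall_inP/idP => [H|ij a].
  by have /forall_inP := H _ (set11 i); apply.
rewrite inE => /eqP->; apply/forall_inP => k kE.
have -> : p i - p k = (p i - p j) - (p k - p j) by rewrite opprB addrA subrK.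
by rewrite dotBr (normal_orth kE jE) subr0.
Qed.

Lemma inwardE T i j : (T :\: E)%SET = [set i]%SET -> j \in E ->
  inward T E = (0 < dot n (p i - p j)).
Proof.
move=> TE jE; rewrite /inward TE; apply/forall_inP/idP => [H|ij a].
  by have /forall_inP := H _ (set11 i); apply.
rewrite inE => /eqP->; apply/forall_inP => k kE.
have -> : p i - p k = (p i - p j) - (p k - p j) by rewrite opprB addrA subrK.
by rewrite dotBr (normal_orth kE jE) subr0.
Qed.

Lemma normal_height_neq0 T i j : T \in neighbors E -> i \in T ->
  E = (T :\ i)%SET -> j \in E -> dot n (p i - p j) != 0.
Proof.
rewrite inE => /andP[Tc _] iT TE jE.
apply: (face_height_neq0 Tc iT); rewrite -?TE //; last exact: normal_orth.
by apply: contra_eq_neq dot_normal => ->; rewrite dot0l eq_sym oner_neq0.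
Qed.

Lemma inwardN T : T \in neighbors E -> inward T E = ~~ outward T E.
Proof.
move=> Tn; have [i [iT TE TDE]] := neighbor_vertex card_face Tn.
have [j jE] := face_inh card_face.
rewrite (inwardE TDE jE) (outwardE TDE jE) -leNgt lt_def.
by rewrite (normal_height_neq0 Tn iT TE jE).
Qed.

Lemma outward_inj : {in neighbors E &, injective (fun T => outward T E)}.
Proof.
move=> T1 T2 T1n T2n.
have [[i1 [i1T E1 TE1]] [i2 [i2T E2 TE2]]] :=
  (neighbor_vertex card_face T1n, neighbor_vertex card_face T2n).
have [T1c T2c] : T1 \in cells M /\ T2 \in cells M.
  by move: T1n T2n; rewrite !inE => /andP[-> _] /andP[-> _].
have [j jE] := face_inh card_face.
have s1 := normal_height_neq0 T1n i1T E1 jE.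
have s2 := normal_height_neq0 T2n i2T E2 jE.
rewrite (outwardE TE1 jE) (outwardE TE2 jE) => s12.
apply: (same_side_eq T1c T2c i1T i2T E1 E2 jE normal_orth).
case: (ltgtP (dot n (p i1 - p j)) 0) s12 s1 => [h1|h1|//].
  by move/esym => h2 _; rewrite nmulr_rgt0.
by move/esym/negbT; rewrite -leNgt => h2 _; rewrite pmulr_rgt0 // lt_def s2.
Qed.

(** An outward neighbor rules out the empty set, the default value in [Tplus]. *)
Lemma TplusP : (exists2 T, T \in neighbors E & outward T E) ->
  Tplus E \in neighbors E /\ outward (Tplus E) E.
Proof.
case=> T Tn To; rewrite /Tplus; case: pickP => [U /andP[]//|/(_ T)].
by rewrite Tn To.
Qed.

Lemma TminusP : (exists2 T, T \in neighbors E & inward T E) ->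
  Tminus E \in neighbors E /\ inward (Tminus E) E.
Proof.
case=> T Tn To; rewrite /Tminus; case: pickP => [U /andP[]//|/(_ T)].
by rewrite Tn To.
Qed.

End Face.

Lemma faces_intW E :
  E \in faces_int M -> E \in (faces_int M :|: faces_bd M)%SET.
Proof. by rewrite finset.in_setU => ->. Qed.

Lemma faces_bdW E :
  E \in faces_bd M -> E \in (faces_int M :|: faces_bd M)%SET.
Proof. by rewrite finset.in_setU orbC => ->. Qed.

(** The orientation on interior faces is derived: [outward] is injective on the two neighbors, so it
    holds for exactly one of them. *)
Lemma neighbors_int E : E \in faces_int M ->
  [/\ neighbors E = [set Tplus E; Tminus E]%SET, Tplus E != Tminus E,
      outward (Tplus E) E & ~~ outward (Tminus E) E].
Proof.
move=> Ei; have Ef := faces_intW Ei; have inj := outward_inj Ef.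
move: Ei; rewrite inE => /andP[_ /cards2P[A [B [AB nE]]]].
have An : A \in neighbors E by rewrite nE !inE eqxx.
have Bn : B \in neighbors E by rewrite nE !inE eqxx orbT.
have AB' : outward A E != outward B E.
  by apply: contra_neq AB; exact: inj.
have [Pn Po] : Tplus E \in neighbors E /\ outward (Tplus E) E.
  apply: TplusP; have [Ao|Ao] := boolP (outward A E); first by exists A.
  by exists B => //; move: AB'; rewrite (negPf Ao); case: (outward B E).
have [Mn Mo] : Tminus E \in neighbors E /\ inward (Tminus E) E.
  apply: TminusP; have [Ao|Ao] := boolP (outward A E); last first.
    by exists A => //; rewrite inwardN.
  exists B => //; rewrite inwardN //.
  by move: AB'; rewrite Ao; case: (outward B E).
move: Mo; rewrite inwardN // => Mo.
have PM : Tplus E != Tminus E by apply: contraNneq Mo => <-.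
split=> //; apply/eqP; rewrite eq_sym eqEcard; apply/andP; split.
  by apply/fintype.subsetP => T; rewrite in_set2 => /orP[] /eqP->.
by rewrite nE !cards2 AB PM.
Qed.

Lemma neighbors_bd E : E \in faces_bd M ->
  neighbors E = [set Tplus E]%SET /\ outward (Tplus E) E.
Proof.
move=> Eb; have Ef := faces_bdW Eb; have out := cm_normal_out cm Eb.
move: Eb; rewrite inE => /andP[_ /cards1P[T nE]].
have Tn : T \in neighbors E by rewrite nE inE.
have [|Pn Po] := @TplusP E; first by exists T => //; exact: out.
by split=> //; move: Pn; rewrite nE inE => /eqP->.
Qed.

Lemma neighbors_cell T E : T \in neighbors E -> T \in cells M.
Proof. by rewrite inE => /andP[]. Qed.

Lemma vol_mesh_face_gt0 E : E \in (faces_int M :|: faces_bd M)%SET -> 0 < vol E.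
Proof.
move=> Ef; have cE := card_face Ef; have [j jE] := face_inh cE.
have [T Tn] : exists T, T \in neighbors E.
  apply/card_gt0P; move: Ef.
  by rewrite !inE => /orP[] /andP[_ /eqP->].
have [i [iT TE _]] := neighbor_vertex cE Tn; have Tc := neighbors_cell Tn.
have jTi := jE; rewrite TE in jTi *.
apply: (vol_face_gt0 (cm_cell_card cm Tc) (cm_cell_indep cm Tc) iT jTi
  (dot_normal Ef)).
by rewrite -TE; exact: normal_orth.
Qed.

End Adjacency.

(** * The divergence theorem on a cell *)

Lemma diff_affine (K : numFieldType) (V W : normedModType K)
    (f : {linear V -> W}) (b : W) (x : V) : continuous f ->
  'd (fun y => f y + b) x = f :> (V -> W).
Proof.
move=> cf; rewrite -[LHS]/('d ((f : V -> W) + cst b) x : V -> W).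
rewrite diffD ?diff_cst ?diff_lin //; last exact: linear_differentiable.
by apply/funext => y /=; rewrite addr0.
Qed.

Section AffineFields.
Variables (R : realType) (d : nat).
Implicit Types (A : 'M[R]_d) (f : 'rV[R]_d -> 'rV[R]_d).

Lemma continuous_mulmxr A : continuous (mulmxr A : 'rV[R]_d -> 'rV[R]_d).
Proof.
rewrite (_ : mulmxr A = fun z => \sum_i z 0 i *: row i A); last first.
  by apply/funext => z; rewrite /= mulmx_sum_row.
apply: continuous_big => [|i _ y]; first exact: add_continuous.
by apply: (@cvgZr_tmp _ _ _ (nbhs y)); exact: coord_continuous.
Qed.

Lemma jacobian_affine A (b x : 'rV[R]_d) :
  'J (fun y : 'rV[R]_d => y *m A + b) x = A.
Proof.
have dE := @diff_affine _ _ _ (mulmxr A : {linear 'rV[R]_d -> 'rV[R]_d}) b x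
  (@continuous_mulmxr A).
apply/row_matrixP => i; rewrite rowE mul_rV_lin1.
by have /= -> := congr1 (fun f => f (delta_mx 0 i)) dE; rewrite rowE.
Qed.

(** Gives canonical names, ['J f 0] and [f 0], to the matrix and the offset of an affine field. *)
Lemma affine_fieldE f : affine_field f ->
  (forall x, f x = x *m 'J f 0 + f 0) /\ (forall x, 'J f x = 'J f 0).
Proof.
case=> A [b /funext fE]; rewrite {}fE.
split=> x; rewrite !jacobian_affine //.
by rewrite mul0mx add0r.
Qed.

Lemma eps_affine f x : affine_field f -> eps f x = eps f 0.
Proof. by case/affine_fieldE=> _ JE; rewrite /eps JE. Qed.

Lemma polyfun_affine_field f i : affine_field f -> polyfun (fun x => f x 0 i).
Proof.
case=> A [b fE].
apply: polyfun_ext (polyfun_affine A b (polyfun_coord i)) => x.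
by rewrite fE addrC.
Qed.

Lemma frobE (A B : 'M[R]_d) : frob A B = \tr (A *m B^T).
Proof.
by apply: eq_bigr => i _; rewrite mxE; apply: eq_bigr => j _; rewrite mxE.
Qed.

Lemma eps_sym f x : (eps f x)^T = eps f x.
Proof. by rewrite /eps linearZ linearD /= trmxK addrC. Qed.

Lemma frob_elastC (mu lambda : R) (A B : 'M[R]_d) :
  frob (elast mu lambda A) B = frob (elast mu lambda B) A.
Proof.
rewrite !frobE /elast !mulmxDl -!scalemxAl !mul_scalar_mx !mxtraceD !mxtraceZ.
rewrite !mxtrace_tr -[\tr (A *m _)]mxtrace_tr trmx_mul trmxK.
by congr (_ + _); rewrite mulrAC.
Qed.

Lemma frob_elast_ge0 (mu lambda : R) (A : 'M[R]_d) : 0 <= mu -> 0 <= lambda ->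
  0 <= frob (elast mu lambda A) A.
Proof.
move=> mu_ge0 lambda_ge0.
rewrite frobE /elast mulmxDl -scalemxAl mul_scalar_mx mxtraceD !mxtraceZ.
rewrite mxtrace_tr -[lambda * _ * _]mulrA -expr2 -frobE addr_ge0 //.
  rewrite !mulr_ge0 // sumr_ge0 // => i _; rewrite sumr_ge0 // => j _.
  by rewrite -expr2 sqr_ge0.
by rewrite mulr_ge0 // sqr_ge0.
Qed.

Lemma elast_sym (mu lambda : R) (A : 'M[R]_d) : A^T = A ->
  (elast mu lambda A)^T = elast mu lambda A.
Proof. by move=> AT; rewrite /elast linearD linearZ /= AT tr_scalar_mx. Qed.

(** A symmetric matrix is orthogonal to the skew part of the gradient. The right-hand side has the
    shape required by [cell_divergence]. *)
Lemma frob_sym_eps (S : 'M[R]_d) f x : S^T = S ->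
  frob S (eps f x) = \tr (S^T *m ('J f x)^T).
Proof.
move=> ST; rewrite frobE eps_sym /eps -scalemxAr mxtraceZ mulmxDr mxtraceD.
rewrite -[\tr (S *m 'J f x)]mxtrace_tr trmx_mul ST mxtrace_mulC.
by field.
Qed.

End AffineFields.

Section Divergence.
Variables (R : realType) (d : nat) (M : mesh R d).
Variables Omega GammaD GammaN : set 'rV[R]_d.
Hypothesis cm : conforming_mesh Omega GammaD GammaN M.
Hypothesis d_gt0 : (0 < d)%N.
Implicit Types T E : {set 'I_(nv M)}.
Local Notation p := (vtx M).

(** For a facet [E] of [T], the unit normal pointing out of [T]. *)
Definition outer T E : 'rV[R]_d :=
  if outward T E then normal M E else - normal M E.

Lemma facet_card T i : T \in cells M -> i \in T -> #|(T :\ i)%SET| = d.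
Proof.
move=> Tc iT; have := cardsD1 i T.
by rewrite iT (cm_cell_card cm Tc) add1n => -[].
Qed.

Lemma facet_neighbor T i : T \in cells M -> T \in neighbors (T :\ i)%SET.
Proof. by move=> Tc; rewrite inE Tc subD1set. Qed.

Lemma face_of_card E : #|E| = d -> (0 < #|neighbors E|)%N ->
  E \in (faces_int M :|: faces_bd M)%SET.
Proof.
move=> cE; have := card_neighbors_le2 cm d_gt0 cE.
by rewrite !inE cE eqxx /=; case: #|neighbors E| => [|[|[]]].
Qed.

Lemma facet_face T i : T \in cells M -> i \in T ->
  (T :\ i)%SET \in (faces_int M :|: faces_bd M)%SET.
Proof.
move=> Tc iT; apply: face_of_card; first exact: facet_card.
by apply/card_gt0P; exists T; exact: facet_neighbor.
Qed.

Definition area_vec T i : 'rV[R]_d :=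
  vol (T :\ i)%SET *: outer T (T :\ i)%SET.

(** So [area_vec T i] is - d |T| times the gradient of the barycentric coordinate of [i]. It
    suffices to take edges from a vertex [j] of the facet; [outer] fixes the sign of the height. *)
Lemma area_vec_edge T i a b : T \in cells M -> i \in T -> a \in T -> b \in T ->
  dot (area_vec T i) (p a - p b)
  = - (d%:R * vol T) * ((a == i)%:R - (b == i)%:R).
Proof.
move=> Tc iT aT bT; have Ef := facet_face Tc iT.
have [cardT indepT] := (cm_cell_card cm Tc, cm_cell_indep cm Tc).
have [j jE] := face_inh d_gt0 (facet_card Tc iT).
have orthN := normal_orth cm Ef.
have TE : (T :\: (T :\ i))%SET = [set i]%SET.
  apply/setP => k; rewrite !inE; have [->|] := eqVneq k i; first by rewrite iT.
  by case: (k \in T).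
have base k : k \in T ->
    dot (area_vec T i) (p k - p j) = - (d%:R * vol T) * (k == i)%:R.
  move=> kT; rewrite dotZl; have [->|ki] := eqVneq k i; last first.
    rewrite mulr0 /outer; have nk : dot (normal M (T :\ i)%SET) (p k - p j) = 0.
      by apply: orthN; rewrite // !inE ki.
    by case: ifP => _; rewrite ?dotNl nk ?oppr0 mulr0.
  rewrite (vol_cell_face cardT indepT iT jE (dot_normal cm Ef) orthN).
  rewrite mulr1 -mulrN; congr (_ * _).
  rewrite /outer (outwardE cm Ef TE jE); case: ltrP => h.
    by rewrite ltr0_norm // opprK.
  by rewrite dotNl ger0_norm.
have -> : p a - p b = (p a - p j) - (p b - p j) by rewrite opprB addrA subrK.
by rewrite dotBr !base // mulrBr.
Qed.

(** The gradients of the barycentric coordinates add up to zero. *)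
Lemma sum_area_vec T : T \in cells M -> \sum_(i in T) area_vec T i = 0.
Proof.
move=> Tc; have [cardT indepT] := (cm_cell_card cm Tc, cm_cell_indep cm Tc).
have delta a : a \in T -> \sum_(i in T) (a == i)%:R = 1 :> R.
  move=> aT; rewrite (bigD1 a) //= eqxx big1 ?addr0 // => i /andP[_].
  by rewrite eq_sym => /negPf->.
apply: (dot_edges_ext cardT indepT) => a b aT bT; rewrite dot0l dot_suml.
under eq_bigr do rewrite area_vec_edge //.
by rewrite -mulr_sumr sumrB !delta // subrr mulr0.
Qed.

(** The divergence theorem for the identity field. Against the edge from b to a only the terms i = a
    and i = b survive, and the vertex sums of these two facets differ by that edge. *)
Lemma sum_area_vec_centroid T : T \in cells M ->
  \sum_(i in T) (area_vec T i)^T *m (d%:R^-1 *: \sum_(j in (T :\ i)%SET) p j)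
  = (vol T)%:M.
Proof.
move=> Tc; have [cardT indepT] := (cm_cell_card cm Tc, cm_cell_indep cm Tc).
have delta a (F : 'I_(nv M) -> 'rV[R]_d) : a \in T ->
    \sum_(i in T) (a == i)%:R *: F i = F a.
  move=> aT; rewrite (bigD1 a) //= eqxx scale1r big1 ?addr0 // => i /andP[_].
  by rewrite eq_sym => /negPf->; rewrite scale0r.
pose c i := \sum_(j in (T :\ i)%SET) p j.
have cE i : i \in T -> c i = \sum_(j in T) p j - p i.
  by move=> iT; rewrite (finset.big_setD1 i iT) /= addrAC subrr add0r.
apply: (edges_ext cardT indepT) => a b aT bT.
rewrite mulmx_sumr mul_mx_scalar.
transitivity (\sum_(i in T) (- vol T) *: (((a == i)%:R - (b == i)%:R) *: c i)).
  apply: eq_bigr => i iT; rewrite mulmxA.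
  rewrite [_ *m (area_vec T i)^T]mx11_scalar -dotE dotC area_vec_edge //.
  rewrite mul_scalar_mx !scalerA; congr (_ *: _).
  have : d%:R != 0 :> R by rewrite pnatr_eq0 -lt0n.
  by move=> d0; field.
rewrite -scaler_sumr; under eq_bigr do rewrite scalerBl.
rewrite sumrB !delta // !cE // opprB addrC addrA subrK scaleNr -scalerN.
by rewrite opprB.
Qed.

(** By [sint_affine] each facet integral is the area times the value at the centroid. [sum_area_vec]
    removes the offset of [f], and [sum_area_vec_centroid] evaluates the linear part. *)
Lemma cell_divergence T (S : 'M[R]_d) f : T \in cells M -> affine_field f ->
  vol T * \tr (S^T *m ('J f 0)^T)
  = \sum_(i in T)
      sint (T :\ i)%SET (fun x => dot (outer T (T :\ i)%SET *m S^T) (f x)).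
Proof.
move=> Tc /affine_fieldE[fE _]; set A := 'J f 0; set b := f 0.
pose c i := d%:R^-1 *: \sum_(j in (T :\ i)%SET) p j.
have d0 : d%:R != 0 :> R by rewrite pnatr_eq0 -lt0n.
transitivity (\sum_(i in T) (dot (area_vec T i *m S^T) (c i *m A)
                             + dot (area_vec T i *m S^T) b)).
  rewrite big_split /= -[X in _ + X]dot_suml -mulmx_suml sum_area_vec //.
  rewrite mul0mx dot0l addr0.
  have -> : \sum_(i in T) dot (area_vec T i *m S^T) (c i *m A)
      = \tr ((S^T *m A^T) *m (\sum_(i in T) (area_vec T i)^T *m c i)^T).
    rewrite raddf_sum mulmx_sumr raddf_sum; apply: eq_bigr => i _ /=.
    rewrite dotE trmx_mul -trace_mx11 -mulmxA mxtrace_mulC -!mulmxA.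
    by rewrite trmx_mul trmxK.
  by rewrite sum_area_vec_centroid // tr_scalar_mx mul_mx_scalar mxtraceZ.
apply: eq_bigr => i iT; set nu := outer _ _.
have -> : (fun x => dot (nu *m S^T) (f x))
    = (fun x => dot (nu *m S^T *m A^T) x + dot (nu *m S^T) b).
  apply/funext => x; rewrite fE dotDr; congr (_ + _).
  by rewrite !dotE trmx_mul !mulmxA.
have cE := facet_card Tc iT.
rewrite sint_affine cE // /area_vec -/nu -[(_ *: nu) *m _]scalemxAl !dotZl.
rewrite -mulrDr; congr (_ * _).
rewrite big_split /= sumr_const cE -dot_sumr mulrDr; congr (_ + _).
  rewrite -dotZr -/(c i) !dotE trmx_mul.
  by rewrite !mulmxA.
by rewrite -[dot _ _ *+ d]mulr_natl mulrA mulVf ?mul1r.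
Qed.

(** * From sums over the facets of cells to sums over faces *)

Lemma sum_disjointU (I : finType) (A B : {set I}) (F : I -> R) :
  (A :&: B = finset.set0)%SET ->
  \sum_(i in (A :|: B)%SET) F i = \sum_(i in A) F i + \sum_(i in B) F i.
Proof.
move=> AB; rewrite !(big_mkcond (fun i => i \in _)) -big_split /=.
apply: eq_bigr => i _; have := congr1 (fun C : {set I} => i \in C) AB.
rewrite !inE; case: (i \in A); case: (i \in B) => //= _.
  by rewrite addr0.
by rewrite add0r.
by rewrite addr0.
Qed.

Lemma faces_int_bd0 : (faces_int M :&: faces_bd M)%SET = finset.set0.
Proof.
by apply/setP => E; rewrite !inE; case: eqP => //= _; case: eqP => // ->.
Qed.

(** Double counting of pairs of a cell and a facet. A set of d vertices contained in no cell
    contributes nothing; any other has one or two neighbors, so is a boundary or an interior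
    face. *)
Lemma sum_facets (F : {set 'I_(nv M)} -> {set 'I_(nv M)} -> R) :
  \sum_(T in cells M) \sum_(i in T) F T (T :\ i)%SET
  = \sum_(E in faces_int M) (F (Tplus E) E + F (Tminus E) E)
    + \sum_(E in faces_bd M) F (Tplus E) E.
Proof.
transitivity (\sum_(T in cells M)
    \sum_(E : {set 'I_(nv M)} | (#|E| == d) && (E \subset T)) F T E).
  apply: eq_bigr => T Tc.
  have inj : {in T &, injective (fun i => T :\ i)%SET}.
    move=> a b aT bT ab; apply/eqP.
    have := congr1 (fun C : {set 'I_(nv M)} => a \in C) ab.
    by rewrite !inE eqxx aT; case: eqP.
  rewrite -(big_imset (F T) inj) /=; apply: eq_bigl => E.
  apply/imsetP/andP => [[i iT ->]|[/eqP cE ET]].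
    by rewrite facet_card // subD1set.
  have [||i [iT EE _]] := @neighbor_vertex _ _ _ _ _ _ cm T E => //.
    by rewrite inE Tc.
  by exists i.
rewrite (exchange_big_dep (fun E : {set 'I_(nv M)} => #|E| == d)) /=;
    last first.
  by move=> T E _ /andP[].
transitivity (\sum_(E in (faces_int M :|: faces_bd M)%SET)
    \sum_(T in neighbors E) F T E).
  rewrite big_mkcond [RHS]big_mkcond; apply: eq_bigr => E _.
  have [/eqP cE|cE] := ifPn; last first.
    case: ifPn => // Ef; case/negP: cE; apply/eqP; exact: (card_face Ef).
  have sumE : \sum_(T in cells M | (#|E| == d) && (E \subset T)) F T E
      = \sum_(T in neighbors E) F T E.
    by apply: eq_bigl => T; rewrite inE cE eqxx.
  rewrite sumE; case: ifPn => // Ef; rewrite big1 // => T Tn.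
  case/negP: Ef; apply: face_of_card => //.
  by apply/card_gt0P; exists T.
rewrite sum_disjointU ?faces_int_bd0 //; congr (_ + _); apply: eq_bigr => E Ef.
  have [-> PM _ _] := neighbors_int cm d_gt0 Ef.
  by rewrite big_setU1 ?inE //= big_set1.
have [{1}-> _] := neighbors_bd cm Ef.
by rewrite big_set1.
Qed.

End Divergence.

(** * Orthogonality for the form A_0 *)

(** The product rule for jumps. The minus sign on [sM] is there because the fixed normal points into
    [Tminus]. *)
Lemma dot_jump_avg (R : realType) (n : nat) (sP sM zP zM : 'rV[R]_n) :
  dot sP zP + dot (- sM) zM
  = dot (zP - zM) (2^-1 *: (sP + sM)) + dot (sP - sM) (2^-1 *: (zP + zM)).
Proof.
rewrite !dotZr !dotBl !dotDr dotNl !(dotC zP) !(dotC zM).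
by field.
Qed.

Section Orthogonality.
Variables (R : realType) (d : nat) (M : mesh R d).
Variables Omega GammaD GammaN : set 'rV[R]_d.
Hypothesis cm : conforming_mesh Omega GammaD GammaN M.
Hypothesis d_gt0 : (0 < d)%N.
Variables mu lambda : R.
Implicit Types (T E : {set 'I_(nv M)}) (z v w : pw M).

Lemma facesD_bd E : E \in facesD M -> E \in faces_bd M.
Proof. by rewrite -(cm_faces_bd cm) finset.in_setU => ->. Qed.

Lemma facesN_bd E : E \in facesN M -> E \in faces_bd M.
Proof. by rewrite -(cm_faces_bd cm) finset.in_setU orbC => ->. Qed.

Lemma faces_oD_face E :
  E \in faces_oD M -> E \in (faces_int M :|: faces_bd M)%SET.
Proof.
by rewrite /faces_oD !finset.in_setU => /orP[->//|/facesD_bd->]; rewrite orbT.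
Qed.

Lemma faces_bd_notint E : E \in faces_bd M -> (E \in faces_int M) = false.
Proof.
move=> Eb; have := congr1 (fun C : {set _} => E \in C) (faces_int_bd0 M).
by rewrite finset.in_setI Eb andbT => ->; rewrite inE.
Qed.

Lemma Tplus_cell E : E \in (faces_int M :|: faces_bd M)%SET ->
  Tplus E \in cells M.
Proof.
rewrite finset.in_setU => /orP[/(neighbors_int cm d_gt0)[nE _ _ _]
                              |/(neighbors_bd cm)[nE _]].
  by apply: (@neighbors_cell _ _ _ _ E); rewrite nE !inE eqxx.
by apply: (@neighbors_cell _ _ _ _ E); rewrite nE !inE eqxx.
Qed.

Lemma Tminus_cell E : E \in faces_int M -> Tminus E \in cells M.
Proof.
case/(neighbors_int cm d_gt0) => nE _ _ _.
by apply: (@neighbors_cell _ _ _ _ E); rewrite nE !inE eqxx orbT.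
Qed.

Lemma polyfun_avg w E i : VDG w -> E \in (faces_int M :|: faces_bd M)%SET ->
  polyfun (fun x => avg w E x 0 i).
Proof.
move=> wDG Ef; have pP := polyfun_affine_field i (wDG _ (Tplus_cell Ef)).
rewrite /avg; have [Ei|//] := boolP (E \in faces_int M).
have pM := polyfun_affine_field i (wDG _ (Tminus_cell Ei)).
apply: polyfun_ext (polyfunM (polyfun_cst 2^-1) (polyfunD pP pM)) => x.
by rewrite !mxE.
Qed.

Lemma polyfun_jump w E i : VDG w -> E \in (faces_int M :|: faces_bd M)%SET ->
  polyfun (fun x => jump w E x 0 i).
Proof.
move=> wDG Ef; have pP := polyfun_affine_field i (wDG _ (Tplus_cell Ef)).
rewrite /jump; have [Ei|//] := boolP (E \in faces_int M).
have pM := polyfun_affine_field i (wDG _ (Tminus_cell Ei)).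
by apply: polyfun_ext (polyfunB pP pM) => x; rewrite !mxE.
Qed.

Lemma tractionE w E T x : VDG w -> T \in cells M ->
  traction mu lambda w E T x = traction mu lambda w E T 0.
Proof. by move=> wDG Tc; rewrite /traction (eps_affine x (wDG _ Tc)). Qed.

Lemma avg_tractionE w E x : VDG w -> E \in (faces_int M :|: faces_bd M)%SET ->
  avg (traction mu lambda w E) E x = avg (traction mu lambda w E) E 0.
Proof.
move=> wDG Ef; have Pc := Tplus_cell Ef.
have tP := tractionE E x wDG Pc.
rewrite /avg; have [Ei|_] := boolP (E \in faces_int M); last exact: tP.
have tM := tractionE E x wDG (Tminus_cell Ei).
by rewrite tP tM.
Qed.

Lemma sint_traction_jump z v E : VDG z -> VCR v -> E \in faces_oD M ->
  sint E (fun x => dot (avg (traction mu lambda z E) E x) (jump v E x)) = 0.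
Proof.
move=> zDG [vDG v0] EoD; have Ef := faces_oD_face EoD.
under eq_fun do rewrite avg_tractionE //.
apply: sint_dot_P0_eq0; last exact: v0.
- by move=> i; exact: polyfun_jump.
- exact: (vol_mesh_face_gt0 cm d_gt0).
Qed.

(** Symmetry of the elasticity tensor puts the stress on [v]; being constant on the cell, it can
    serve as the matrix in [cell_divergence]. *)
Lemma energyE z v : VDG z -> VDG v ->
  energy mu lambda z v = \sum_(T in cells M) \sum_(i in T)
    sint (T :\ i)%SET (fun x => dot (outer T (T :\ i)%SET
      *m (elast mu lambda (eps (v T) 0))^T) (z T x)).
Proof.
move=> zDG vDG; apply: eq_bigr => T Tc.
rewrite -(cell_divergence cm d_gt0 _ Tc (zDG _ Tc)).
rewrite (_ : (fun x => _) = fun=>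
    frob (elast mu lambda (eps (z T) 0)) (eps (v T) 0)); last first.
  apply/funext => x.
  by rewrite (eps_affine x (zDG _ Tc)) (eps_affine x (vDG _ Tc)).
rewrite sint_cst mulrC frob_elastC frob_sym_eps //.
by rewrite elast_sym // eps_sym.
Qed.

(** [F] is the facet term of the energy, [G] the consistency term with the traction of [v]. On
    interior faces the two values of [F] add up to [G] plus a term killed by the mean of the average
    of [z]; on Dirichlet faces [F] is [G]; on Neumann faces [F] is zero. Thus the energy cancels the
    consistency terms. *)
Lemma formA0_orth alpha0 z v : Zspace z -> VCR v ->
  formA0 mu lambda alpha0 z v = 0.
Proof.
move=> [zDG z0] vCR; have [vDG v0] := vCR.
rewrite /formA0 energyE //.
pose F T E := sint E (fun x => dot (outer T E *m
  (elast mu lambda (eps (v T) 0))^T) (z T x)).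
rewrite -/(\sum_(T in cells M) \sum_(i in T) F T (T :\ i)%SET).
rewrite (sum_facets cm d_gt0 F).
pose G E :=
  sint E (fun x => dot (jump z E x) (avg (traction mu lambda v E) E x)).
have outT T E : outward T E ->
    outer T E *m (elast mu lambda (eps (v T) 0))^T = traction mu lambda v E T 0.
  by rewrite /outer => ->.
have inT T E : ~~ outward T E ->
    outer T E *m (elast mu lambda (eps (v T) 0))^T
    = - traction mu lambda v E T 0.
  by rewrite /outer => /negPf->; rewrite mulNmx.
have pz E c : E \in (faces_int M :|: faces_bd M)%SET ->
    polyfun (fun x => dot c (z (Tplus E) x)).
  move=> Ef; apply: polyfun_dot => i; first exact: polyfun_cst.
  exact: polyfun_affine_field (zDG _ (Tplus_cell Ef)).
have Fint E : E \in faces_int M -> F (Tplus E) E + F (Tminus E) E = G E.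
  move=> Ei; have Ef := faces_intW Ei.
  have [_ _ Po Mo] := neighbors_int cm d_gt0 Ei.
  rewrite /F outT // inT //.
  set tP := traction _ _ _ _ _ _; set tM := traction _ _ _ _ _ _.
  have avg0 : sint E (fun x => dot (tP - tM) (avg z E x)) = 0.
    apply: sint_dot_P0_eq0; last by apply: z0; rewrite finset.in_setU Ei.
    - by move=> i; exact: polyfun_avg.
    - exact: (vol_mesh_face_gt0 cm d_gt0).
  rewrite -sintD; [|exact: pz|]; last first.
    apply: polyfun_dot => i; first exact: polyfun_cst.
    exact: polyfun_affine_field (zDG _ (Tminus_cell Ei)).
  rewrite -[RHS]addr0 -avg0 -sintD; first last.
  - apply: polyfun_dot => i; first exact: polyfun_cst.
    exact: polyfun_avg.
  - apply: polyfun_dot => i; first exact: polyfun_jump.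
    under eq_fun do rewrite avg_tractionE //.
    exact: polyfun_cst.
  congr (sint E _); apply/funext => x.
  rewrite avg_tractionE // /avg /jump Ei -/tP -/tM.
  exact: dot_jump_avg.
have Fbd E : E \in faces_bd M -> F (Tplus E) E = G E.
  move=> Eb; have [_ Po] := neighbors_bd cm Eb.
  rewrite /F /G outT //; congr (sint E _); apply/funext => x.
  rewrite avg_tractionE ?faces_bdW // /avg /jump faces_bd_notint //.
  by rewrite dotC.
have FN E : E \in facesN M -> F (Tplus E) E = 0.
  move=> EN; have Eb := facesN_bd EN; have [_ Po] := neighbors_bd cm Eb.
  have Ef := faces_bdW Eb.
  have zE x : z (Tplus E) x = avg z E x by rewrite /avg faces_bd_notint.
  rewrite /F; under eq_fun do rewrite zE.
  apply: sint_dot_P0_eq0; last by apply: z0; rewrite finset.in_setU EN orbT.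
  - by move=> i; exact: polyfun_avg.
  - exact: (vol_mesh_face_gt0 cm d_gt0).
have oD0 : (faces_int M :&: facesD M)%SET = finset.set0.
  apply/setP => E; rewrite finset.in_setI finset.in_set0.
  have [/facesD_bd/faces_bd_notint->//|] := boolP (E \in facesD M).
  by rewrite andbF.
rewrite (eq_bigr _ Fint) -(cm_faces_bd cm) sum_disjointU ?(cm_faces_disj cm) //.
rewrite [X in _ + (_ + X)]big1 // addr0.
have -> : \sum_(E in facesD M) F (Tplus E) E = \sum_(E in facesD M) G E.
  by apply: eq_bigr => E /facesD_bd; exact: Fbd.
rewrite -sum_disjointU // -/(faces_oD M).
have -> : \sum_(E in faces_oD M)
    sint E (fun x => dot (avg (traction mu lambda z E) E x) (jump v E x)
                   + dot (jump z E x) (avg (traction mu lambda v E) E x))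
    = \sum_(E in faces_oD M) G E.
  apply: eq_bigr => E EoD; have Ef := faces_oD_face EoD.
  rewrite sintD ?sint_traction_jump ?add0r //.
    under eq_fun do rewrite avg_tractionE //.
    apply: polyfun_dot => i; first exact: polyfun_cst.
    exact: polyfun_jump.
  apply: polyfun_dot => i; first exact: polyfun_jump.
  under eq_fun do rewrite avg_tractionE //.
  exact: polyfun_cst.
(* What remains is the [alpha0] penalty, which contains the mean of the jump of [v]. *)
rewrite subrr add0r big1 ?mulr0 // => E EoD.
under eq_fun do rewrite v0 // dot0r.
by rewrite sint_cst mul0r mulr0.
Qed.

End Orthogonality.

(** * The strengthened Cauchy-Schwarz inequality *)

Lemma discriminant_le (R : realFieldType) (a b c : R) :
  (forall t, 0 <= a + 2 * t * b + t ^+ 2 * c) -> 0 <= c -> b ^+ 2 <= a * c.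
Proof.
move=> quad c_ge0; have [c0|c_neq0] := eqVneq c 0.
  have [->|b_neq0] := eqVneq b 0; first by rewrite c0 expr0n mulr0.
  (* For c = 0 the expression is affine in t, and this t gives it the value -1. *)
  have := quad (- (a + 1) / (2 * b)).
  rewrite c0 mulr0 addr0 => h; suff: 0 <= -1 :> R by rewrite ler0N1.
  by apply: le_trans h _; rewrite le_eqVlt; apply/orP; left; apply/eqP; field.
have c_gt0 : 0 < c by rewrite lt_def c_neq0.
(* The minimizer of the quadratic. *)
have := mulr_ge0 c_ge0 (quad (- b / c)).
have -> : c * (a + 2 * (- b / c) * b + (- b / c) ^+ 2 * c) = a * c - b ^+ 2.
  by field.
by rewrite subr_ge0.
Qed.

Section FaceForm.
Variables (R : realType) (d : nat) (M : mesh R d).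
Variable F : {set {set 'I_(nv M)}}.
Implicit Types a b : {set 'I_(nv M)} -> 'rV[R]_d -> 'rV[R]_d.

(** The arguments are arbitrary fields on faces, not jumps of piecewise fields, so that a jump minus
    its mean also fits. *)
Definition face_form a b : R :=
  \sum_(E in F) (hE E)^-1 * sint E (fun x => dot (a E x) (b E x)).

Definition poly_on a := forall E i, E \in F -> polyfun (fun x => a E x 0 i).

Lemma hE_ge0 (E : {set 'I_(nv M)}) : 0 <= hE E.
Proof.
rewrite /hE /diam; set S := [set _ | _].
(* If there is no supremum, [sup] takes its default value 0. *)
have [hs|/sup_out->//] := pselect (has_sup S).
have [[r Sr] _] := hs; apply: le_trans (sup_upper_bound hs Sr).
by case: Sr => x [y [_ _ ->]]; exact: sqrtr_ge0.
Qed.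

Lemma face_form_ge0 a : 0 <= face_form a a.
Proof.
rewrite sumr_ge0 // => E _; rewrite mulr_ge0 ?invr_ge0 ?hE_ge0 //.
by apply: sint_ge0 => x; exact: dot_ge0.
Qed.

Lemma face_form_sqr_le a b : poly_on a -> poly_on b ->
  face_form a b ^+ 2 <= face_form a a * face_form b b.
Proof.
move=> pa pb; apply: discriminant_le (face_form_ge0 b) => t.
apply: le_trans (face_form_ge0 (fun E x => a E x + t *: b E x)) _.
rewrite le_eqVlt; apply/orP; left; apply/eqP.
rewrite /face_form !mulr_sumr -!big_split /=; apply: eq_bigr => E EF.
have [pE qE] : (forall i, polyfun (fun x => a E x 0 i)) /\
    (forall i, polyfun (fun x => b E x 0 i)).
  by split=> i; [exact: pa | exact: pb].
have -> : (fun x => dot (a E x + t *: b E x) (a E x + t *: b E x))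
    = (fun x => t ^+ 2 * dot (b E x) (b E x)
                + (2 * t * dot (a E x) (b E x) + dot (a E x) (a E x))).
  apply/funext => x; rewrite !dotDl !dotDr !dotZl !dotZr (dotC (b E x) (a E x)).
  by ring.
have pc (f : 'rV[R]_d -> R) (c : R) : polyfun f -> polyfun (fun x => c * f x).
  by move=> pf; apply: polyfunM => //; exact: polyfun_cst.
rewrite sint_lin; [|exact: polyfun_dot|]; last first.
  apply: polyfunD; last exact: polyfun_dot.
  by apply: pc; exact: polyfun_dot.
rewrite sint_lin; [|exact: polyfun_dot|exact: polyfun_dot].
by ring.
Qed.

End FaceForm.

Section Energy.
Variables (R : realType) (d : nat) (M : mesh R d).
Implicit Types w : pw M.
Variables mu lambda : R.
Hypotheses (mu_gt0 : 0 < mu) (lambda_ge0 : 0 <= lambda).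

Lemma formA0_ge0 alpha0 w : 0 <= alpha0 -> penalty_ok M mu lambda alpha0 ->
  VDG w -> 0 <= formA0 mu lambda alpha0 w w.
Proof.
move=> alpha0_ge0 pen wDG; apply: le_trans (pen w wDG); rewrite addr_ge0 //.
  rewrite mulr_ge0 // sumr_ge0 // => T _; apply: sint_ge0 => x.
  by apply: frob_elast_ge0 => //; exact: ltW.
rewrite !mulr_ge0 ?invr_ge0 //.
  by rewrite addr_ge0 // !mulr_ge0 // ltW.
rewrite sumr_ge0 // => E _; rewrite mulr_ge0 ?invr_ge0 ?hE_ge0 //.
by apply: sint_ge0 => x; exact: dot_ge0.
Qed.

Lemma formAE alpha0 alpha1 w1 w2 : formA mu lambda alpha0 alpha1 w1 w2
  = formA0 mu lambda alpha0 w1 w2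
    + alpha1 * beta1 mu * face_form (faces_oD M) (jump w1) (jump w2).
Proof. by []. Qed.

End Energy.

Theorem lemma4p2 (R : realType) (alpha0 alpha1 rho : R)
    (halpha0 : 1 <= alpha0) (halpha1 : 0 < alpha1) (hrho : 1 <= rho) :
  exists gamma : R, [/\ 0 <= gamma, gamma < 1 &
    forall (d : nat) (Omega GammaD GammaN : set 'rV[R]_d) (M : mesh R d)
           (sigma mu1 mu2 mu lambda : R),
      (d = 2%N \/ d = 3%N) ->
      conforming_mesh Omega GammaD GammaN M ->
      shape_regular M sigma ->
      0 < mu1 -> mu1 < mu -> mu < mu2 -> 0 <= lambda ->
      penalty_ok M mu lambda alpha0 ->
      rho_ok M rho ->
      forall z v : pw M, Zspace z -> VCR v ->
        formA mu lambda alpha0 alpha1 z v ^+ 2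
        <= gamma ^+ 2 * formA mu lambda alpha0 alpha1 z z
                      * formA mu lambda alpha0 alpha1 v v].
Proof.
have rho_gt0 : 0 < rho by apply: lt_le_trans hrho.
have g_ge0 : 0 <= 1 - rho^-1 by rewrite subr_ge0 invf_le1.
exists (Num.sqrt (1 - rho^-1)); split; first exact: sqrtr_ge0.
  by rewrite -[ltRHS]sqrtr1 ltr_sqrt // ltrBlDr ltrDl invr_gt0.
move=> d Omega GammaD GammaN M sigma mu1 mu2 mu lambda d23 cm _ mu1_gt0 mu1_lt _
  lambda_ge0 pen hrho_ok z v zZ vCR.
have d_gt0 : (0 < d)%N by case: d23 => ->.
have mu_gt0 := lt_trans mu1_gt0 mu1_lt.
have [[zDG z0] [vDG v0]] := (zZ, vCR).
rewrite sqr_sqrtr //; set g := 1 - _ in g_ge0 *.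
set B := face_form (faces_oD M).
set s := alpha1 * beta1 mu; have s_ge0 : 0 <= s by rewrite !mulr_ge0 ?ltW.
(* Since [formA0] is nonnegative on the diagonal, the [alpha1] penalty is bounded by the whole
   form. *)
have lower w : VDG w ->
    s * B (jump w) (jump w) <= formA mu lambda alpha0 alpha1 w w.
  move=> wDG; rewrite formAE lerDr formA0_ge0 //.
  exact: le_trans halpha0.
pose z' E x := jump z E x - P0 E (jump z E).
have pjump w : VDG w -> poly_on (faces_oD M) (jump w).
  move=> wDG E i EoD.
  exact: (polyfun_jump cm d_gt0 _ wDG (faces_oD_face cm EoD)).
have pz' : poly_on (faces_oD M) z'.
  move=> E i EoD.
  apply: polyfun_ext (polyfunB (pjump z zDG E i EoD)
    (polyfun_cst (P0 E (jump z E) 0 i))) => x.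
  by rewrite !mxE.
have zvE : formA mu lambda alpha0 alpha1 z v = s * B z' (jump v).
  rewrite formAE (formA0_orth cm d_gt0) // add0r; congr (_ * _).
  apply: eq_bigr => E EoD; congr (_ * _); have Ef := faces_oD_face cm EoD.
  rewrite (_ : (fun x => dot (z' E x) _) = fun x =>
    dot (jump z E x) (jump v E x) - dot (P0 E (jump z E)) (jump v E x)).
    rewrite sintB; [|apply: polyfun_dot => i; exact: pjump|]; last first.
      by apply: polyfun_dot => i; [exact: polyfun_cst | exact: pjump].
    rewrite sint_dot_P0_eq0 ?subr0 //; last exact: v0.
      by move=> i; exact: pjump.
    exact: (vol_mesh_face_gt0 cm d_gt0).
  by apply/funext => x; rewrite dotBl.
have CS := face_form_sqr_le pz' (pjump v vDG); rewrite -/B in CS.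
have rhoz : B z' z' <= g * B (jump z) (jump z) by exact: hrho_ok.
have B_ge0 w : 0 <= B (jump w) (jump w) by exact: face_form_ge0.
rewrite zvE exprMn.
(* The intermediate quantity keeps only the penalties: [lower] bounds it by the right-hand side,
   while [CS] and [rhoz] bound the left-hand side by it. *)
apply: le_trans (_ : g * (s * B (jump z) (jump z)) * (s * B (jump v) (jump v))
                     <= _); last first.
  have sB_ge0 w : 0 <= s * B (jump w) (jump w) by exact: mulr_ge0.
  apply: ler_pM; [exact: mulr_ge0 | exact: sB_ge0 | | exact: lower].
  by apply: ler_wpM2l; [ | exact: lower].
have -> : g * (s * B (jump z) (jump z)) * (s * B (jump v) (jump v))
    = s ^+ 2 * (g * B (jump z) (jump z) * B (jump v) (jump v)) by ring.
rewrite ler_wpM2l ?sqr_ge0 //; apply: le_trans CS _.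
by rewrite ler_wpM2r.
Qed.
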